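(* Consider a FCFS $M/GI/n$ queue with Markovian (exponentially distributed) inter-arrival times distributed as $A$, and service times distributed as $S$ satisfying $\mathbb{E}[S] < \infty$. Suppose also that $\mu_A < n\mu_S$, and that $Q(\infty)$ and $\overline{W}_{\mathrm{service}}(\infty)$ exist. Then the steady-state probability of delay satisfies $$\mathbb{P}\big(Q(\infty) \geq n\big) \leq \frac{1}{2}\sqrt{\rho}\,\big(n(1-\rho)^2\big)^{-\frac{1}{2}}.$$
   Context: A FCFS $M/GI/n$ queue has $n \ge 1$ identical servers and an infinite waiting room; inter-arrival times are i.i.d. distributed as the exponential random variable $A$ (Poisson arrivals of rate $\mu_A$), service times are i.i.d. distributed as the non-negative random variable $S$ with $\mathbb{E}[S] > 0$, the two sequences are independent, and jobs are served first-come-first-serve. For a random variable $X$, $\mu_X = 1/\mathbb{E}[X]$. The traffic intensity is $\rho = \frac{\mu_A}{n\mu_S}$. ''$Q(\infty)$ exists'' means that the total number of jobs in the system (in service plus waiting in queue) converges in distribution as time tends to infinity, independently of the particular initial condition, to a random variable $Q(\infty)$. ''$\overline{W}_{\mathrm{service}}(\infty)$ exists'' means that the (sorted) vector of residual service times of the jobs currently in service converges in distribution, independently of the initial condition, to a random vector $\overline{W}_{\mathrm{service}}(\infty)$. *)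

(* Defs.v *)
From HB Require Import structures.
From mathcomp Require Import all_boot all_order all_algebra finmap.
From mathcomp Require Import all_classical all_reals all_analysis.
Set Implicit Arguments.
Unset Strict Implicit.
Unset Printing Implicit Defensive.
Import Order.TTheory GRing.Theory Num.Theory.
Import numFieldNormedType.Exports.
Local Open Scope classical_set_scope.
Local Open Scope ring_scope.

(* The state at time 0: the number of jobs in the system and the residual
   service times of those in service.  No server idles while a job waits, hence
   the constraint on the number of residual times. *)
Record initial_state (R : realType) (n : nat) := InitialState {
  in_system : nat ;
  residuals : seq R ;
  size_residuals : size residuals = minn in_system n ;
  residuals_gt0 : all (fun r => 0 < r) residuals }.

(* In the definitions below, [a i] is the i-th inter-arrival time and [s i] the
   i-th service time, both indexed from 0.  Jobs are numbered in their order of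
   service: first the jobs initially in service, then those initially waiting
   (which, like all later arrivals, draw their service times from [s]), then the
   arrivals.  The first arrival occurs at time [a 0]. *)

Definition arrival (R : realType) (n : nat) (x : initial_state R n)
    (a : nat -> R) (k : nat) : R :=
  if (k < in_system x)%N then 0
  else \sum_(i < (k - in_system x).+1) a i.

Definition service (R : realType) (n : nat) (x : initial_state R n)
    (s : nat -> R) (k : nat) : R :=
  if (k < size (residuals x))%N then nth 0 (residuals x) k
  else s (k - size (residuals x))%N.

(* [free_times x a s k] lists in increasing order the times from which the n
   servers have no work left among jobs 0, ..., k-1; job k is given to the
   server that is free first (Kiefer-Wolfowitz recursion). *)
Fixpoint free_times (R : realType) (n : nat) (x : initial_state R n)
    (a s : nat -> R) (k : nat) : seq R :=
  if k is k'.+1 then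
    let F := free_times x a s k' in
    sort <=%R
      (Num.max (arrival x a k') (head 0 F) + service x s k' :: behead F)
  else nseq n 0.

Definition start (R : realType) (n : nat) (x : initial_state R n)
    (a s : nat -> R) (k : nat) : R :=
  Num.max (arrival x a k) (head 0 (free_times x a s k)).

Definition departure (R : realType) (n : nat) (x : initial_state R n)
    (a s : nat -> R) (k : nat) : R :=
  start x a s k + service x s k.

(* [fset_set] sends infinite sets to [fset0]; this only matters on the null
   event that infinitely many jobs arrive in bounded time. *)
Definition number_in_system (R : realType) (n : nat) (x : initial_state R n)
    (a s : nat -> R) (t : R) : nat :=
  #|` fset_set [set k : nat | arrival x a k <= t < departure x a s k] |.

(* The residual service times are sorted in decreasing order and padded with
   zeros, one for each idle server, by the default value of [nth]. *)
Definition residual_service (R : realType) (n : nat) (x : initial_state R n)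
    (a s : nat -> R) (t : R) : 'rV[R]_n :=
  \row_(i < n) nth 0
    (sort >=%R [seq departure x a s k - t |
       k <- fset_set [set k : nat | start x a s k <= t < departure x a s k]])
    i.

Definition mutually_independent (R : realType) (d : measure_display)
    (T : measurableType d) (P : probability T R) (I : choiceType)
    (X : I -> {RV P >-> R}) : Prop :=
  forall (J : {fset I}) (B : I -> set R),
    (forall i, measurable (B i)) ->
    P (\bigcap_(i in [set` J]) (X i @^-1` B i)) =
    (\prod_(i <- J) P (X i @^-1` B i))%E.

Definition same_law (R : realType) (d : measure_display)
    (T : measurableType d) (P : probability T R) (X Y : {RV P >-> R}) : Prop :=
  forall B : set R, measurable B -> distribution P X B = distribution P Y B.

Definition exponential_law (R : realType) (d : measure_display)
    (T : measurableType d) (P : probability T R) (X : {RV P >-> R}) : Prop :=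
  exists2 rate : R, 0 < rate &
    forall B : set R, measurable B -> distribution P X B = exponential_prob rate B.

(* Convergence in distribution, as time tends to infinity, of an E-valued
   process to an E-valued random element, possibly on another space. *)
Definition cvg_in_law (R : realType) (d d' : measure_display)
    (T : measurableType d) (T' : measurableType d')
    (P : probability T R) (P' : probability T' R) (E : topologicalType)
    (X : R -> T -> E) (Y : T' -> E) : Prop :=
  forall f : E -> R, continuous f -> (exists M : R, forall e, `|f e| <= M) ->
    (fun t : R => 'E_P[f \o X t])%E @ +oo --> ('E_P'[f \o Y])%E.

(* mu_X = 1 / E[X] *)
Definition rate_of (R : realType) (d : measure_display)
    (T : measurableType d) (P : probability T R) (X : {RV P >-> R}) : R :=
  (fine 'E_P[X]%E)^-1.

Definition traffic_intensity (R : realType) (d : measure_display)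
    (T : measurableType d) (P : probability T R) (n : nat)
    (A S : {RV P >-> R}) : R :=
  rate_of A / (n%:R * rate_of S).

(* [a] and [s] are the sequences of inter-arrival and service times. *)
Record MGIn (R : realType) (d : measure_display) (T : measurableType d)
    (P : probability T R) (A S : {RV P >-> R}) (a s : nat -> {RV P >-> R}) :
    Prop := {
  MGIn_exponential : exponential_law A ;
  MGIn_service_ge0 : {ae P, forall w, 0 <= S w} ;
  MGIn_service_mean_gt0 : (0 < 'E_P[S])%E ;
  MGIn_arrival_law : forall i, same_law (a i) A ;
  MGIn_service_law : forall i, same_law (s i) S ;
  (* independence within each sequence and between the two sequences *)
  MGIn_independent :
    mutually_independent
      (fun i : nat + nat => match i with inl j => a j | inr j => s j end) }.

(* "Q(oo) exists".  Quantifying over deterministic initial states is enough: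
   convergence from a random initial state independent of [a] and [s] follows
   by conditioning. *)
Definition steady_state_number (R : realType) (d d' : measure_display)
    (T : measurableType d) (T' : measurableType d')
    (P : probability T R) (P' : probability T' R) (n : nat)
    (a s : nat -> {RV P >-> R}) (Qinf : {RV P' >-> nat}) : Prop :=
  forall x : initial_state R n,
    cvg_in_law P P'
      (fun t w => number_in_system x (fun i => a i w) (fun i => s i w) t) Qinf.

(* "W_service(oo) exists".  A random vector is a map to ['rV[R]_n] with
   measurable coordinates. *)
Definition steady_state_residual (R : realType) (d d' : measure_display)
    (T : measurableType d) (T' : measurableType d')
    (P : probability T R) (P' : probability T' R) (n : nat)
    (a s : nat -> {RV P >-> R}) (Winf : T' -> 'rV[R]_n) : Prop :=
  (forall i : 'I_n, measurable_fun [set: T'] (fun w => Winf w 0 i)) /\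
  forall x : initial_state R n,
    cvg_in_law P P'
      (fun t w => residual_service x (fun i => a i w) (fun i => s i w) t) Winf.

(* Main.v *)
Require Import Defs.
From HB Require Import structures.
From mathcomp Require Import all_boot all_order all_algebra finmap.
From mathcomp Require Import all_classical all_reals all_analysis.
From mathcomp Require Import measurable_realfun ring lra.
Import Order.TTheory GRing.Theory Num.Theory.
Import numFieldNormedType.Exports.
Local Open Scope classical_set_scope.
Local Open Scope ring_scope.

Set Implicit Arguments.
Unset Strict Implicit.
Unset Printing Implicit Defensive.

(** Write c = n * rho = lambda * E[S] < n.  Whatever q is,
      (n - c) * [n <= q] + c <= min(q, n) + (c - q)^+,
    so the bound follows from two facts about Q = Q(oo):

    - E[min(Q, n)] <= c.  Since no server idles while a job waits, min(Q, n) is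
      the number of busy servers, and the work done by the servers up to time t
      is at most the total service time of the jobs arrived by then, whose mean
      is lambda * t * E[S].  To compare a single time with such an average, the
      process is sampled on a grid of mesh delta: over L grid points a job of
      length s is seen at most s / delta + 1 times, which replaces c by
      c + lambda * delta, and delta is then sent to 0
      ([busy_work_le], [mean_busy_grid_le], [grid_limit_le]).

    - E[(c - Q)^+] <= sqrt(c) / 2.  A job does not leave before its arrival time
      plus its service time, so the queue holds at least as many jobs as the
      system with infinitely many servers fed by the same input.  There the
      number Y of jobs is Poisson with a mean m <= c that tends to c; only
      E[Y] = m and E[Y (Y - 1)] <= c^2 are used, and they give
      E[(c - Y)^+] <= sqrt(c) / 2 in the limit ([infinite_server_le],
      [deficit_mean_le], [mean_deficit_le]).

    Hence (n - c) P(Q >= n) <= sqrt(c) / 2, which is the claim.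

    Both expectations are limits of expectations of the queue started empty.

    The Poisson input enters through one identity.  For f >= 0 put
    H(y) = integral of lambda * f over [y, +oo[.  If A is exponential of rate
    lambda, then H(y) = E[f(y + A)] + E[H(y + A)] ([tail_integral_renewal]).
    Iterated along the arrival times G_1 < G_2 < ..., it says that the sum of
    the E[f(y + G_k)], k <= N, is H(y) up to the remainder E[H(y + G_N)]
    ([renewal_sum]); neither the law of G_k nor that of the counting process has
    to be computed.  One use gives E[Y], two nested uses give E[Y (Y - 1)].

    The number of jobs is not shown to be a measurable function of the outcome.
    The integral of a nonnegative function is a supremum over the simple
    functions below it, hence monotone and superadditive without measurability,
    and this suffices because the expectations of the queue are only bounded from
    above by expectations of measurable functions. *)

(** * Integrals of nonnegative functions without measurability *)

Section lower_integral.
Context d (T : measurableType d) (R : realType) (mu : {measure set T -> \bar R}).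
Local Open Scope ereal_scope.
Import HBNNSimple.

Lemma ge0_le_integral_lower (f g : T -> \bar R) :
  (forall x, 0 <= f x) -> (forall x, f x <= g x) ->
  \int[mu]_x f x <= \int[mu]_x g x.
Proof.
move=> f0 fg; have g0 x : 0 <= g x := le_trans (f0 x) (fg x).
rewrite !ge0_integralTE//; apply: le_ereal_sup => _ [h /= hf <-].
by exists h => //= x; exact: le_trans (hf x) (fg x).
Qed.

(** Simple functions below [f] and below [g] add up to a simple function below
    [f + g]; equality would need measurability. *)
Lemma ge0_integralD_lower (f g : T -> \bar R) :
  (forall x, 0 <= f x) -> (forall x, 0 <= g x) ->
  \int[mu]_x f x + \int[mu]_x g x <= \int[mu]_x (f x + g x).
Proof.
move=> f0 g0; have fg0 x : 0 <= f x + g x by rewrite adde_ge0.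
have [->|] := eqVneq (\int[mu]_x (f x + g x)) +oo; first exact: leey.
rewrite -ltey => fgoo.
have fin h : 0 <= h -> h <= \int[mu]_x (f x + g x) -> h \is a fin_num.
  by move=> h0 hle; rewrite ge0_fin_numE// (le_lt_trans hle).
have ffin : \int[mu]_x f x \is a fin_num.
  apply: fin; first exact: integral_ge0.
  by apply: ge0_le_integral_lower => // x; rewrite leeDl.
rewrite -leeBrDl// [leLHS]ge0_integralTE//; apply: ge_ereal_sup => _ [h /= hg <-].
have hfin : sintegral mu h \is a fin_num.
  apply: fin; first exact: sintegral_ge0.
  rewrite -integralT_nnsfun; apply: ge0_le_integral_lower => x.
    by rewrite lee_fin fun_ge0.
  by rewrite (le_trans (hg x))// leeDr.
rewrite leeBrDl// -leeBrDr// ge0_integralTE//.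
apply: ge_ereal_sup => _ [k /= kf <-].
rewrite leeBrDr// -sintegralD -integralT_nnsfun.
apply: ge0_le_integral_lower => x; first by rewrite lee_fin fun_ge0.
by rewrite /= EFinD leeD.
Qed.

Lemma ge0_integral_sum_lower (I : Type) (s : seq I) (f : I -> T -> \bar R) :
  (forall i x, 0 <= f i x) ->
  \sum_(i <- s) \int[mu]_x f i x <= \int[mu]_x \sum_(i <- s) f i x.
Proof.
move=> f0; elim: s => [|i s IHs].
  by rewrite big_nil; apply: integral_ge0 => x _; rewrite big_nil.
rewrite big_cons [leRHS](eq_integral (fun x => f i x + \sum_(j <- s) f j x)); last first.
  by move=> x _; rewrite big_cons.
apply: le_trans (ge0_integralD_lower _ _) => //; first by rewrite leeD2l.
by move=> x; exact: sume_ge0.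
Qed.

Lemma ge0_le_integral_lower_ae (N : set T) (f g : T -> \bar R) :
  mu.-negligible N -> measurable_fun [set: T] g ->
  (forall x, 0 <= f x) -> (forall x, 0 <= g x) ->
  (forall x, ~ N x -> f x <= g x) ->
  \int[mu]_x f x <= \int[mu]_x g x.
Proof.
move=> [M [mM M0 NM]] mg f0 g0 fg.
(* [h] dominates [f] everywhere and has the integral of [g]. *)
pose h x := if x \in M then +oo else g x.
rewrite (_ : \int[mu]_x g x = \int[mu]_x h x).
  apply: ge0_le_integral_lower => // x; rewrite /h.
  case: ifPn => [_|/negP xM]; first exact: leey.
  by apply: fg => /NM xM'; apply: xM; rewrite inE.
apply: ge0_ae_eq_integral => //.
- apply: measurable_fun_ifT => //.
  apply: (measurable_fun_bool true); rewrite setTI (_ : _ @^-1` _ = M)//.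
  by apply/seteqP; split => x /= => [/set_mem//|/mem_set].
- by move=> x _; rewrite /h; case: ifP.
- exists M; split => // x /= /not_implyP[_]; rewrite /h.
  by case: ifPn => // /set_mem.
Qed.

End lower_integral.
(** * Independence *)

Section independent_pair.
Context d (T : measurableType d) (R : realType) (P : probability T R).
Context d1 d2 (E1 : measurableType d1) (E2 : measurableType d2).
Local Open Scope ereal_scope.

Definition independent_pair (U : T -> E1) (V : T -> E2) : Prop :=
  forall B C, measurable B -> measurable C ->
  P (U @^-1` B `&` V @^-1` C) = P (U @^-1` B) * P (V @^-1` C).

(** Integrating two independent variables is integrating the second one over a
    separate copy of the probability space: both sides integrate [h] against the
    product of the two laws. *)
Lemma integral_independent_pair (U : T -> E1) (V : T -> E2)
    (h : E1 * E2 -> \bar R) :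
  measurable_fun [set: T] U -> measurable_fun [set: T] V ->
  independent_pair U V ->
  measurable_fun [set: E1 * E2] h -> (forall z, 0 <= h z) ->
  \int[P]_w h (U w, V w) = \int[P]_w \int[P]_w' h (U w, V w').
Proof.
move=> mU mV indep mh h0.
pose U' : {mfun T >-> E1} := HB.pack U (isMeasurableFun.Build _ _ _ _ _ mU).
pose V' : {mfun T >-> E2} := HB.pack V (isMeasurableFun.Build _ _ _ _ _ mV).
have mUV : measurable_fun [set: T] (fun w => (U w, V w)).
  exact: measurable_fun_pair.
pose UV : {mfun T >-> (E1 * E2)%type} :=
  HB.pack (fun w => (U w, V w)) (isMeasurableFun.Build _ _ _ _ _ mUV).
transitivity (\int[distribution P UV]_z h z).
  by rewrite ge0_integral_distribution.
transitivity (\int[(distribution P U' \x distribution P V')%E]_z h z).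
  apply: eq_measure_integral => A mA _; apply/esym.
  by apply: product_measure_unique => // B C mB mC; exact: indep.
rewrite fubini_tonelli1//= ge0_integral_distribution//.
- apply: eq_integral => w _ /=.
  by rewrite /fubini_F ge0_integral_distribution//; exact: measurable_fun_pair2.
- exact: measurable_fun_fubini_tonelli_F.
- by move=> x; apply: integral_ge0.
Qed.

End independent_pair.

Section disjoint_blocks.
Context d (T : measurableType d) (R : realType) (P : probability T R).
Context (I : choiceType) (X : I -> {RV P >-> R}).
Local Open Scope ereal_scope.

(** The events that constrain finitely many of the variables indexed by [J]: they
    are stable under intersection and generate the sigma-algebra of these
    variables. *)
Definition cylinders (J : set I) : set (set T) :=
  [set E | exists F : {fset I}, exists B : I -> set R,
    [/\ [set` F] `<=` J, (forall i, measurable (B i)) &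
        E = \bigcap_(i in [set` F]) (X i @^-1` B i)]].

Lemma cylinders_setT J : cylinders J [set: T].
Proof.
exists fset0, (fun=> setT); split => //.
by apply/seteqP; split => // w _ i.
Qed.

Lemma cylinders_setI J : setI_closed (cylinders J).
Proof.
move=> _ _ [F [B [FJ mB ->]]] [G [C [GJ mC ->]]].
exists (F `|` G)%fset.
exists (fun i => (if i \in F then B i else setT) `&`
                 (if i \in G then C i else setT)); split.
- by move=> i /=; rewrite in_fsetU => /orP[/FJ|/GJ].
- by move=> i; apply: measurableI; case: ifP.
- apply/seteqP; split => [w [wF wG] i /= _|w FG].
    by split; case: ifPn => // ?; [exact: wF|exact: wG].
  split => i /= iFG; have /= := FG i; rewrite in_fsetU iFG ?orbT => /(_ isT).
    by case.
  by case.
Qed.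

Lemma measurable_cylinders J : cylinders J `<=` measurable.
Proof.
move=> _ [F [B [FJ mB ->]]]; apply: fin_bigcap_measurable => //.
by move=> i _; rewrite -[X in measurable X]setTI; apply: measurable_funP.
Qed.

Lemma measurable_g_cylinders J : <<s cylinders J >> `<=` measurable.
Proof.
apply: smallest_sub; first exact: sigma_algebra_measurable.
exact: measurable_cylinders.
Qed.

Definition depends_on (J : set I) d1 (E : measurableType d1) (U : T -> E) :=
  measurable_fun [set: g_sigma_algebraType (cylinders J)] U.

Lemma depends_on_measurable J d1 (E : measurableType d1) (U : T -> E) :
  depends_on J U -> measurable_fun [set: T] U.
Proof.
by move=> JU _ B mB; apply: (@measurable_g_cylinders J); exact: JU.
Qed.

Lemma depends_on_coord (J : set I) i : J i -> depends_on J (X i).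
Proof.
move=> Ji _ B mB; rewrite setTI; apply: sub_sigma_algebra.
exists [fset i]%fset, (fun=> B); split => //.
  by move=> j /=; rewrite inE => /eqP ->.
apply/seteqP; split => [w wB j /=|w]; first by rewrite inE => /eqP ->.
by apply; rewrite /= inE.
Qed.

(** The product rule holds by hypothesis for cylinders, and extends to the
    sigma-algebras they generate by uniqueness of measures. *)
Lemma mutually_independent_blocks (J K : set I) d1 d2
    (E1 : measurableType d1) (E2 : measurableType d2)
    (U : T -> E1) (V : T -> E2) :
  mutually_independent X -> J `&` K = set0 ->
  depends_on J U -> depends_on K V -> independent_pair P U V.
Proof.
move=> indepX JK0 JU KV B C mB mC.
have cyl A D : cylinders J A -> cylinders K D -> P (A `&` D) = P A * P D.
  move=> [F [B1 [FJ mB1 ->]]] [G [B2 [GK mB2 ->]]].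
  have FG0 : [disjoint F & G]%fset.
    apply/fdisjointP => i iF; apply/negP => iG.
    suff : (J `&` K) i by rewrite JK0.
    by split; [exact: FJ|exact: GK].
  have -> : \bigcap_(i in [set` F]) (X i @^-1` B1 i) `&`
            \bigcap_(i in [set` G]) (X i @^-1` B2 i) =
     \bigcap_(i in [set` (F `|` G)%fset])
        (X i @^-1` (if i \in F then B1 i else B2 i)).
    apply/seteqP; split => [w [wF wG] i /=|w FG].
      by rewrite in_fsetU; case: ifPn => [/wF//|_ /= /wG].
    split => i /= iFG; have /= := FG i; rewrite in_fsetU iFG ?orbT => /(_ isT)//.
    by case: ifPn => // iF; move/fdisjointP : FG0 => /(_ _ iF); rewrite iFG.
  rewrite indepX; last by move=> i; case: ifP.
  rewrite !indepX// (perm_big (F ++ G)) /=; last first.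
    apply: uniq_perm => [||i]; rewrite ?fset_uniq//.
      rewrite cat_uniq !fset_uniq/= andbT; apply/hasPn => i /= iG.
      by move/fdisjointP_sym : FG0 => /(_ _ iG).
    by rewrite in_fsetU mem_cat.
  rewrite big_cat/=.
  congr (_ * _); apply: eq_big_seq => i iF; first by rewrite iF.
  by move/fdisjointP_sym : FG0 => /(_ _ iF)/negPf ->.
(* With one event fixed, both sides of the product rule are finite measures of the
   other event, so that they agree once they agree on cylinders.  The cylinder of
   [K] is generalized first, then that of [J]. *)
have scaleE A (mA : measurable A) D : mscale (NngNum (fine_ge0 (measure_ge0 P A))) P D = P A * P D.
  by rewrite /mscale/= fineK// fin_num_measure.
have cylJ A D : cylinders J A -> <<s cylinders K >> D -> P (A `&` D) = P A * P D.
  move=> JA KD; have mA := measurable_cylinders JA.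
  rewrite setIC -[LHS]/(mrestr P mA D) -(scaleE A mA).
  apply: (g_sigma_algebra_measure_unique (cylinders K) _ (fun=> setT)) => //.
  - exact: measurable_cylinders.
  - by move=> _; exact: cylinders_setT.
  - by apply/seteqP; split => // x _; exists 0%N.
  - exact: cylinders_setI.
  - by move=> G KG; rewrite [RHS]scaleE// /= /mrestr setIC cyl.
  - by move=> _ /=; rewrite /mrestr setTI (le_lt_trans (probability_le1 _ _))// ltry.
have sJ : <<s cylinders J >> (U @^-1` B) by rewrite -[U @^-1` B]setTI; exact: JU.
have sK : <<s cylinders K >> (V @^-1` C) by rewrite -[V @^-1` C]setTI; exact: KV.
have mV := measurable_g_cylinders sK.
rewrite -[LHS]/(mrestr P mV _) muleC -(scaleE _ mV).
apply: (g_sigma_algebra_measure_unique (cylinders J) _ (fun=> setT)) => //.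
- exact: measurable_cylinders.
- by move=> _; exact: cylinders_setT.
- by apply/seteqP; split => // x _; exists 0%N.
- exact: cylinders_setI.
- by move=> G JG; rewrite [RHS]scaleE// /= /mrestr cylJ// muleC.
- by move=> _ /=; rewrite /mrestr setTI (le_lt_trans (probability_le1 _ _))// ltry.
Qed.

End disjoint_blocks.
(** * Lebesgue integrals *)

Section lebesgue_translation.
Context (R : realType).
Notation mu := (@lebesgue_measure R).
Local Open Scope ereal_scope.

Lemma lebesgue_measure_addr (y : R) (A : set R) : measurable A ->
  pushforward mu (+%R^~ y : _ -> measurableTypeR R) A = mu A.
Proof.
have maddr : measurable_fun [set: R] (+%R^~ y : _ -> measurableTypeR R).
  exact: measurable_funD.
pose addr : {mfun R >-> measurableTypeR R} :=
  HB.pack (+%R^~ y : R -> measurableTypeR R) (isMeasurableFun.Build _ _ _ _ _ maddr).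
move=> mA; apply/esym; apply: (@lebesgue_measure_unique _ (pushforward mu addr)) => //= _ [[a b]] _ <-.
have -> : pushforward mu (+%R^~ y : _ -> measurableTypeR R) `](a, b).1, (a, b).2] =
  mu `](a - y)%R, (b - y)%R]%classic.
  congr (mu _); apply/seteqP; split => x /=; rewrite !in_itv/= ltrBlDr lerBrDr //.
rewrite !lebesgue_measure_itv/= !lte_fin ltrD2r -!EFinB.
by case: ifP => // _; congr (_%:E); ring.
Qed.

Lemma ge0_integral_addr (y : R) (f : R -> \bar R) :
  measurable_fun [set: R] f -> (forall x, 0 <= f x) ->
  \int[mu]_x f (x + y)%R = \int[mu]_x f x.
Proof.
move=> mf f0.
have maddr : measurable_fun [set: R] (+%R^~ y : _ -> measurableTypeR R).
  exact: measurable_funD.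
transitivity (\int[pushforward mu (+%R^~ y : _ -> measurableTypeR R)]_x f x).
  by rewrite ge0_integral_pushforward.
by apply: eq_measure_integral => A mA _; exact: lebesgue_measure_addr.
Qed.

End lebesgue_translation.

Section triangle.
Context (R : realType) (g : R -> \bar R).
Hypotheses (mg : measurable_fun [set: R] g) (g0 : forall z, (0 <= g z)%E).
Notation mu := (@lebesgue_measure R).
Local Open Scope ereal_scope.

Let mgg : measurable_fun [set: R * R] (fun p : R * R => g p.1 * g p.2).
Proof. by apply: emeasurable_funM; exact: measurableT_comp. Qed.

Let mlt z : measurable_fun [set: R] (fun x => if (x < z)%R then g z * g x else 0).
Proof.
apply: measurable_fun_ifT => //; first exact: measurable_fun_ltr.
exact: measurable_funeM.
Qed.

Let mle z : measurable_fun [set: R] (fun x => if (z <= x)%R then g z * g x else 0).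
Proof.
apply: measurable_fun_ifT => //; first exact: measurable_fun_ler.
exact: measurable_funeM.
Qed.

Let mle2 : measurable_fun [set: R * R]
  (fun p : R * R => if (p.1 <= p.2)%R then g p.1 * g p.2 else 0).
Proof. by apply: measurable_fun_ifT => //; exact: measurable_fun_ler. Qed.

Let mlt2 : measurable_fun [set: R * R]
  (fun p : R * R => if (p.2 < p.1)%R then g p.1 * g p.2 else 0).
Proof. by apply: measurable_fun_ifT => //; exact: measurable_fun_ltr. Qed.

Let triangle_swap :
  \int[mu]_z \int[mu]_x (if (z <= x)%R then g z * g x else 0) =
  \int[mu]_z \int[mu]_x (if (x < z)%R then g z * g x else 0).
Proof.
transitivity (\int[mu]_z \int[mu]_x (if (x <= z)%R then g x * g z else 0)).
  apply: (fubini_tonelli (m1 := mu) (m2 := mu)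
    (fun p : R * R => if (p.1 <= p.2)%R then g p.1 * g p.2 else 0)); last first.
  - by move=> p; case: ifP => _; [exact: mule_ge0|exact: lexx].
  - exact: mle2.
apply: eq_integral => z _; apply: ge0_ae_eq_integral => //.
- apply: measurable_fun_ifT => //; first exact: measurable_fun_ler.
  by apply: emeasurable_funM.
- exact: mlt.
- by move=> x _; case: ifP => _; [exact: mule_ge0|exact: lexx].
- by move=> x _; case: ifP => _; [exact: mule_ge0|exact: lexx].
- exists [set z]; split => //; first exact: lebesgue_measure_set1.
  move=> x /= /not_implyP[_].
  by case: ltgtP => // _; rewrite muleC.
Qed.

(** The two halves of the plane cut by the diagonal carry the same integral of the
    symmetric function [g z * g x], by Fubini, and the diagonal is null. *)
Lemma integral_triangle :
  \int[mu]_z \int[mu]_x (if (z <= x)%R then g z * g x else 0) +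
  \int[mu]_z \int[mu]_x (if (z <= x)%R then g z * g x else 0) =
  \int[mu]_z g z * \int[mu]_z g z.
Proof.
rewrite [X in _ + X]triangle_swap -ge0_integralD; last 5 first.
- exact: measurableT.
- move=> z _; apply: integral_ge0 => x _.
  by case: ifP => _; [exact: mule_ge0|exact: lexx].
- apply: (measurable_fun_fubini_tonelli_F (m2 := mu)
    (fun p : R * R => if (p.1 <= p.2)%R then g p.1 * g p.2 else 0)); last first.
  - by move=> p; case: ifP => _; [exact: mule_ge0|exact: lexx].
  - exact: mle2.
- move=> z _; apply: integral_ge0 => x _.
  by case: ifP => _; [exact: mule_ge0|exact: lexx].
- apply: (measurable_fun_fubini_tonelli_F (m2 := mu)
    (fun p : R * R => if (p.2 < p.1)%R then g p.1 * g p.2 else 0)); last first.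
  - by move=> p; case: ifP => _; [exact: mule_ge0|exact: lexx].
  - exact: mlt2.
rewrite -ge0_integralZl; [|exact: measurableT|exact: mg|by move=> z _; exact: g0|
  by apply: integral_ge0 => z _; exact: g0].
apply: eq_integral => z _; rewrite muleC.
rewrite -ge0_integralZl; [|exact: measurableT|exact: mg|by move=> x _; exact: g0|exact: g0].
rewrite -ge0_integralD.
- by apply: eq_integral => x _; case: leP; rewrite ?adde0 ?add0e.
- by [].
- by move=> x _; case: ifP => _; [exact: mule_ge0|exact: lexx].
- exact: mle.
- by move=> x _; case: ifP => _; [exact: mule_ge0|exact: lexx].
- exact: mlt.
Qed.

End triangle.

(** * The renewal identity of the exponential law *)

Section exponential.
Context d (T : measurableType d) (R : realType) (P : probability T R).
Context (rate : R) (rate_gt0 : (0 < rate)%R) (X : {RV P >-> R}).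
Hypothesis X_law : forall B : set R, measurable B ->
  distribution P X B = exponential_prob rate B.
Notation mu := (@lebesgue_measure R).
Notation pdf := (exponential_pdf rate).
Local Open Scope ereal_scope.

Let pdf_ge0 x : (0 <= pdf x)%R.
Proof. by apply: exponential_pdf_ge0; exact: ltW. Qed.

Let measurable_pdf : measurable_fun [set: R] (EFin \o pdf).
Proof. by apply/measurable_EFinP; exact: measurable_exponential_pdf. Qed.

Import Radon_Nikodym_SigmaFinite.

(** The law of [X] is dominated by the Lebesgue measure, and its Radon-Nikodym
    derivative is almost everywhere the exponential density. *)
Lemma ge0_integral_exponential (f : R -> \bar R) :
  measurable_fun [set: R] f -> (forall x, 0 <= f x) ->
  \int[P]_w f (X w) = \int[mu]_x ((pdf x)%:E * f x).
Proof.
move=> mf f0.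
have mX : measurable_fun [set: T] (X : T -> measurableTypeR R).
  exact: (@measurable_funPT _ _ _ _ X).
pose X' : {mfun T >-> measurableTypeR R} :=
  HB.pack (X : T -> measurableTypeR R) (isMeasurableFun.Build _ _ _ _ _ mX).
have X'_law A : measurable A -> distribution P X' A = exponential_prob rate A.
  exact: X_law.
have dom : distribution P X' `<< mu.
  apply/null_content_dominatesP => A mA muA; rewrite X'_law//.
  by apply: null_set_integral => //; exact: measurable_funTS.
transitivity (\int[distribution P X']_x f x); first by rewrite ge0_integral_distribution.
rewrite -(change_of_variables dom)//.
under [RHS]eq_integral do rewrite muleC.
have frn := f_integrable dom.
apply: ge0_ae_eq_integral => //.
- by apply: emeasurable_funM => //; exact: measurable_int frn.
- by apply: emeasurable_funM.
- by move=> x _; rewrite mule_ge0// f_ge0.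
- by move=> x _; rewrite mule_ge0// lee_fin.
- apply: ae_eqe_mul2l; apply: integral_ae_eq => //.
  by move=> E _ mE; rewrite -(f_integral dom)//; exact: X'_law.
Qed.


Lemma integral_exponential_pdf_le (u : R) :
  \int[mu]_x (if (x <= u)%R then (pdf x)%:E else 0) =
  (if (0 <= u)%R then (1 - expR (- rate * u))%R else 0%R)%:E.
Proof.
transitivity (\int[mu]_(x in `[0%R, u]) (pdf x)%:E).
  rewrite [RHS]integral_mkcond; apply: eq_integral => x _.
  rewrite patchE mem_setE in_itv/=; case: (leP x u) => xu; rewrite ?andbT ?andbF//.
  by case: leP => // x0; rewrite lt0_exponential_pdf.
case: ltgtP => u0.
- by rewrite EFinB -exponential_prob_itv0c.
- by rewrite set_itv_ge ?integral_set0// bnd_simp -ltNge.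
- by rewrite -u0 set_itv1 integral_set1 mulr0 expR0 subrr.
Qed.

Definition tail_integral (f : R -> \bar R) (y : R) : \bar R :=
  \int[mu]_z (if (y <= z)%R then rate%:E * f z else 0).

Section renewal.
Context (f : R -> \bar R) (mf : measurable_fun [set: R] f).
Hypothesis f_ge0 : forall z, 0 <= f z.

Lemma tail_integral_ge0 y : 0 <= tail_integral f y.
Proof.
apply: integral_ge0 => z _; case: ifP => // _.
by rewrite mule_ge0// lee_fin ltW.
Qed.

Let measurable_tail_integrand :
  measurable_fun [set: R * R]
    (fun p : R * R => if (p.1 <= p.2)%R then rate%:E * f p.2 else 0).
Proof.
apply: measurable_fun_ifT => //; first exact: measurable_fun_ler.
by apply: measurable_funeM; exact: measurableT_comp.
Qed.

Lemma measurable_tail_integral : measurable_fun [set: R] (tail_integral f).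
Proof.
apply: (measurable_fun_fubini_tonelli_F (m2 := mu)
  (fun p : R * R => if (p.1 <= p.2)%R then rate%:E * f p.2 else 0)) => //.
move=> p; case: ifP => // _; by rewrite mule_ge0// lee_fin ltW.
Qed.

(** With u = z - y >= 0, the coefficient of [f z] is [rate * expR (- rate * u)] in
    the first integral, from the density of [X], and
    [rate * (1 - expR (- rate * u))] in the second one, from its distribution
    function; they add up to [rate]. *)
Lemma tail_integral_renewal (y : R) :
  \int[P]_w f (y + X w)%R + \int[P]_w tail_integral f (y + X w)%R =
  tail_integral f y.
Proof.
have mshift : measurable_fun [set: R] (fun x : R => (y + x)%R).
  exact: measurable_funD.
rewrite (ge0_integral_exponential (f := fun x => f (y + x)%R))//; last first.
  exact: measurableT_comp.
rewrite (ge0_integral_exponential (f := fun x => tail_integral f (y + x)%R))//;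
    last 2 first.
- apply: (measurableT_comp measurable_tail_integral); exact: mshift.
- by move=> x; exact: tail_integral_ge0.
have -> : \int[mu]_x ((pdf x)%:E * f (y + x)%R) =
          \int[mu]_z ((pdf (z - y))%:E * f z).
  rewrite -(ge0_integral_addr (- y))//.
  - by apply: eq_integral => z _; rewrite [(y + _)%R]addrC subrK.
  - by apply: emeasurable_funM => //; exact: measurableT_comp.
  - by move=> x; rewrite mule_ge0// lee_fin.
have -> : \int[mu]_x ((pdf x)%:E * tail_integral f (y + x)%R) =
    \int[mu]_z (rate%:E * f z *
      (if (0 <= z - y)%R then (1 - expR (- rate * (z - y)))%R else 0%R)%:E).
  transitivity (\int[mu]_x \int[mu]_z
      (if (x <= z - y)%R then rate%:E * f z * (pdf x)%:E else 0)).
    apply: eq_integral => x _; rewrite -ge0_integralZl//.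
    - apply: eq_integral => z _; rewrite addrC lerBrDr.
      by case: ifP => _; rewrite ?mule0// muleC.
    - apply: measurable_fun_ifT => //; first exact: measurable_fun_ler.
      exact: measurable_funeM.
    - move=> z _; case: ifP => // _; by rewrite mule_ge0// lee_fin ltW.
    - by rewrite lee_fin.
  transitivity (\int[mu]_z \int[mu]_x
      (if (x <= z - y)%R then rate%:E * f z * (pdf x)%:E else 0)).
    apply: (fubini_tonelli (m1 := mu) (m2 := mu) (fun p : R * R =>
      if (p.1 <= p.2 - y)%R then rate%:E * f p.2 * (pdf p.1)%:E else 0)).
      apply: measurable_fun_ifT => //.
        by apply: measurable_fun_ler => //; exact: measurable_funB.
      apply: emeasurable_funM; last exact: (measurableT_comp measurable_pdf).
      by apply: measurable_funeM; exact: measurableT_comp.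
    by move=> p; case: ifP => // _; rewrite !mule_ge0// lee_fin ?pdf_ge0// ltW.
  apply: eq_integral => z _; rewrite -integral_exponential_pdf_le -ge0_integralZl//.
  - by apply: eq_integral => x _; case: ifP; rewrite ?mule0.
  - by apply: measurable_fun_ifT => //; exact: measurable_fun_ler.
  - by move=> x _; case: ifP => // _; rewrite lee_fin.
  - by rewrite mule_ge0// lee_fin ltW.
have cdf_ge0 u : (0 <= (if (0 <= u)%R then 1 - expR (- rate * u) else 0%R))%R.
  case: ifP => // u0; rewrite subr_ge0 -expR0 ler_expR mulNr oppr_le0.
  by rewrite mulr_ge0// ltW.
rewrite -ge0_integralD//.
- apply: eq_integral => z _; rewrite -(subr_ge0 y z) muleAC -ge0_muleDl ?mule_ge0 ?lee_fin//.
  + case: ifPn => [zy|zy].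
      rewrite exponential_pdfE// -EFinM -EFinD; congr (_%:E * _); ring.
    by rewrite mule0 adde0 lt0_exponential_pdf ?mul0e// ltNge.
  + exact: ltW.
- by move=> z _; rewrite mule_ge0// lee_fin.
- apply: emeasurable_funM => //; apply: (measurableT_comp measurable_pdf).
  exact: measurable_funB.
- by move=> z _; rewrite !mule_ge0// lee_fin// ltW.
- apply: emeasurable_funM; first exact: measurable_funeM.
  apply/measurable_EFinP; apply: measurable_fun_ifT => //.
    by apply: measurable_fun_ler => //; exact: measurable_funB.
  apply: measurable_funB => //; apply: measurableT_comp => //.
  by apply: measurable_funM => //; exact: measurable_funB.
Qed.

(** The integral of a function against its own tail, which comes from pairs of
    arrivals counted once, is half of the square of the total integral. *)
Lemma tail_integral_square :
  tail_integral (fun z => f z * tail_integral f z) 0 +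
  tail_integral (fun z => f z * tail_integral f z) 0 =
  tail_integral f 0 * tail_integral f 0.
Proof.
have rate0 : 0 <= rate%:E by rewrite lee_fin ltW.
pose g (z : R) : \bar R := if (0 <= z)%R then rate%:E * f z else 0.
have g0 z : 0 <= g z by rewrite /g; case: ifP => // _; exact: mule_ge0.
have mg : measurable_fun [set: R] g.
  apply: measurable_fun_ifT => //; first exact: measurable_fun_ler.
  exact: measurable_funeM.
have tailE : tail_integral (fun z => f z * tail_integral f z) 0 =
    \int[mu]_z \int[mu]_x (if (z <= x)%R then g z * g x else 0).
  apply: eq_integral => z _; have [z0|z0] := leP 0%R z.
    rewrite muleA -ge0_integralZl//.
    - apply: eq_integral => x _; rewrite /g z0; case: leP => zx; rewrite ?mule0//.
      by rewrite (le_trans z0 zx).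
    - apply: measurable_fun_ifT => //; first exact: measurable_fun_ler.
      exact: measurable_funeM.
    - by move=> x _; case: ifP => // _; exact: mule_ge0.
    - exact: mule_ge0.
  apply/esym/integral0_eq => x _; rewrite /g [(0 <= z)%R]leNgt z0/= mul0e.
  by case: ifP.
by rewrite tailE; exact: integral_triangle.
Qed.

End renewal.


Lemma exponential_negligible_lt0 : P.-negligible [set w | (X w < 0)%R].
Proof.
have mB : measurable (`]-oo, 0%R[ : set R) by exact: measurable_itv.
exists (X @^-1` `]-oo, 0%R[); split.
- by rewrite -[X in measurable X]setTI; exact: measurable_funPT.
- rewrite -[LHS]/(distribution P X _) X_law//; apply: integral0_eq => x /=.
  by rewrite in_itv/= => x0; rewrite lt0_exponential_pdf.
- by move=> w /= w0; rewrite in_itv.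
Qed.

Lemma integral_exponential_pdf_gt (z : R) : (0 <= z)%R ->
  \int[mu]_x (if (z < x)%R then (pdf x)%:E else 0) = (expR (- rate * z))%:E.
Proof.
move=> z0; have le := integral_exponential_pdf_le z; rewrite z0 in le.
have := integral_exponential_pdf rate_gt0.
have -> : \int[mu]_x (pdf x)%:E =
    \int[mu]_x ((if (x <= z)%R then (pdf x)%:E else 0) +
                (if (z < x)%R then (pdf x)%:E else 0)).
  by apply: eq_integral => x _; case: leP => _; rewrite ?adde0 ?add0e.
rewrite ge0_integralD//= ?le; last 4 first.
- by move=> x _; case: ifP => // _; rewrite lee_fin.
- by apply: measurable_fun_ifT => //; exact: measurable_fun_ler.
- by move=> x _; case: ifP => // _; rewrite lee_fin.
- by apply: measurable_fun_ifT => //; exact: measurable_fun_ltr.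
set J := \int[mu]_x _ => /eqP.
case: J => [r||]//; rewrite -EFinD eqe => /eqP H.
by congr (_%:E); lra.
Qed.

(** By Fubini, E[X] is the integral over z >= 0 of
    P(X > z) = [expR (- rate * z)]. *)
Lemma exponential_mean : 'E_P[X] = (rate^-1)%:E.
Proof.
rewrite expectation_def.
transitivity (\int[P]_w (Num.max (X w) 0)%:E).
  apply: ae_eq_integral => //.
  - exact/measurable_EFinP.
  - by apply/measurable_EFinP; exact: measurable_maxr.
  - have [N [mN N0 XN]] := exponential_negligible_lt0.
    exists N; split => // w /= /not_implyP[_ neq]; apply: XN => /=.
    by rewrite ltNge; apply: contra_notN neq => X0; rewrite max_l.
rewrite (ge0_integral_exponential (f := fun x => (Num.max x 0)%:E)); last 2 first.
- by apply/measurable_EFinP; exact: measurable_maxr.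
- by move=> x; rewrite lee_fin le_max lexx orbT.
pose g (p : R * R) : \bar R :=
  if (0 <= p.2)%R && (p.2 < p.1)%R then (pdf p.1)%:E else 0.
have mg : measurable_fun [set: R * R] g.
  apply: measurable_fun_ifT => //; last exact: (measurableT_comp measurable_pdf).
  by apply: measurable_and => /=; [apply: measurable_fun_ler|apply: measurable_fun_ltr].
have g0 p : 0 <= g p by rewrite /g; case: ifP => // _; rewrite lee_fin.
transitivity (\int[mu]_x \int[mu]_z g (x, z)).
  apply: eq_integral => x _; transitivity (\int[mu]_(z in `[0%R, x[) (pdf x)%:E).
    rewrite integral_cst//= lebesgue_measure_itv/= lte_fin; congr (_ * _).
    by case: ltP => x0; rewrite ?max_l ?max_r ?oppr0 ?addr0 ?sube0// ltW.
  rewrite integral_mkcond; apply: eq_integral => z _.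
  by rewrite patchE mem_setE in_itv.
rewrite (fubini_tonelli (m1 := mu) (m2 := mu) g)//.
transitivity (\int[mu]_z ((rate^-1)%:E * (pdf z)%:E)).
  apply: eq_integral => z _; rewrite /g/=; have [z0|z0] := leP 0%R z.
    rewrite integral_exponential_pdf_gt// exponential_pdfE// -EFinM.
    by rewrite mulrA mulVf ?gt_eqF// mul1r.
  by rewrite lt0_exponential_pdf// mule0 integral0.
rewrite ge0_integralZl//= ?integral_exponential_pdf ?mule1//.
  by move=> x _; rewrite lee_fin.
by rewrite lee_fin invr_ge0 ltW.
Qed.
End exponential.
(** * The system with infinitely many servers *)

(** Each pair of distinct indices appears once, as [j] and [j + 1 + m]. *)
Lemma sqr_sum_bool (R : comNzRingType) (b : nat -> bool) N :
  (\sum_(k < N) (b k)%:R) ^+ 2 = \sum_(k < N) (b k)%:R +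
    (\sum_(j < N) \sum_(m < N - j.+1) (b j && b (j.+1 + m)%N)%:R) *+ 2 :> R.
Proof.
elim: N b => [|N IHN] b; first by rewrite !big_ord0 expr0n mul0rn addr0.
rewrite !big_ord_recl /= sqrrD subSS subn0.
have -> : \sum_(m < N) (b 0%N && b (1 + m)%N)%:R =
    (b 0%N)%:R * \sum_(k < N) (b (bump 0 k))%:R :> R.
  by rewrite mulr_sumr; apply: eq_bigr => k _; rewrite -mulnb natrM.
rewrite (IHN (fun k => b (bump 0 k))).
have -> : ((b 0%N)%:R : R) ^+ 2 = (b 0%N)%:R by case: (b 0%N); rewrite ?expr1n ?expr0n.
set b0 : R := (b 0%N)%:R; set y : R := \sum_(k < N) _; set z : R := \sum_(j < N) _.
transitivity (b0 + y + (b0 * y + z) *+ 2); first ring.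
by [].
Qed.

Section poisson_arrivals.
Context d (T : measurableType d) (R : realType) (P : probability T R).
Context (a s : nat -> {RV P >-> R}) (S : {RV P >-> R}) (lam : R).
Hypothesis lam_gt0 : 0 < lam.
Hypothesis a_law : forall i (B : set R), measurable B ->
  distribution P (a i) B = exponential_prob lam B.
Hypothesis s_law : forall i, same_law (s i) S.
Let input (i : nat + nat) := match i with inl j => a j | inr j => s j end.
Hypothesis input_indep : mutually_independent input.
Notation mu := (@lebesgue_measure R).
Local Open Scope ereal_scope.

(** The time elapsed during [m] consecutive inter-arrival periods from the period
    [o] on.  Job [k] arrives at [partial_sum 0 k.+1], and [partial_sum j.+1 m.+1]
    is the time between the arrivals of the jobs [j] and [j + 1 + m]. *)
Definition partial_sum (o m : nat) (w : T) : R := (\sum_(i < m) a (o + i) w)%R.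

Let arrivals (o m : nat) : set (nat + nat) :=
  [set i | exists2 j, (o <= j < o + m)%N & i = inl j].

Let depends_on_partial_sum (J : set (nat + nat)) o m :
  arrivals o m `<=` J -> depends_on input J (partial_sum o m).
Proof.
move=> oJ; apply: measurable_sum => i.
apply: (depends_on_coord (i := inl (o + i)%N)); apply: oJ.
by exists (o + i)%N => //; rewrite leq_addr ltn_add2l ltn_ord.
Qed.

Lemma measurable_partial_sum o m : measurable_fun [set: T] (partial_sum o m).
Proof. by apply: measurable_sum. Qed.

(** The renewal identity, applied at each arrival to the next inter-arrival time,
    which is independent of the past.  Hence, for arrivals counted from time [y],
    the expected sum of [f] over the arrival times is at most the integral of
    [lam * f] over [y, +oo[, and the difference is the remainder of the
    iteration. *)
Lemma renewal_sum (f : R -> \bar R) (o N : nat) (y : R) :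
  measurable_fun [set: R] f -> (forall z, 0 <= f z) ->
  \sum_(m < N) \int[P]_w f (y + partial_sum o m.+1 w)%R +
    \int[P]_w tail_integral lam f (y + partial_sum o N w)%R =
  tail_integral lam f y.
Proof.
move=> mf f0; have mH := measurable_tail_integral lam_gt0 mf f0.
have H0 := tail_integral_ge0 lam_gt0 f0.
elim: N => [|N IHN].
  rewrite big_ord0 add0e; under eq_integral do rewrite /partial_sum big_ord0 addr0.
  transitivity (\int[P]_w (cst (tail_integral lam f y)) w) => //.
  rewrite (integral_cst P measurableT) -[RHS]mule1; congr (_ * _).
  exact: probability_setT.
rewrite -[RHS]IHN big_ord_recr/= -addeA; congr (_ + _).
have indep : independent_pair P (partial_sum o N) (a (o + N)).
  apply: (mutually_independent_blocks (J := arrivals o N)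
     (K := [set inl (o + N)%N]) input_indep).
  - rewrite -subset0 => i [[j /andP[_ jN] ->]] /= [jE].
    by rewrite jE ltnn in jN.
  - exact: depends_on_partial_sum.
  - exact: (depends_on_coord (i := inl (o + N)%N)).
have split (g : R -> \bar R) : measurable_fun [set: R] g -> (forall z, 0 <= g z) ->
    \int[P]_w g (y + partial_sum o N.+1 w)%R =
    \int[P]_w \int[P]_w' g ((y + partial_sum o N w) + a (o + N)%N w')%R.
  move=> mg g0.
  rewrite -(integral_independent_pair (h := fun p => g ((y + p.1) + p.2)%R))//.
  - by apply: eq_integral => w _; rewrite /partial_sum big_ord_recr/= addrA.
  - exact: measurable_partial_sum.
  - apply: (measurableT_comp mg); apply: measurable_funD => //.
    exact: measurable_funD.
have measurable_split (g : R -> \bar R) : measurable_fun [set: R] g ->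
    (forall z, 0 <= g z) ->
    measurable_fun [set: T]
      (fun w => \int[P]_w' g ((y + partial_sum o N w) + a (o + N)%N w')%R).
  move=> mg g0.
  apply: (measurableT_comp (measurable_fun_fubini_tonelli_F (m2 := P)
    (fun p : R * T => g ((y + p.1) + a (o + N)%N p.2)%R) _ _)) => //.
    apply: (measurableT_comp mg); apply: measurable_funD => //.
      exact: measurable_funD.
    exact: measurableT_comp.
  exact: measurable_partial_sum.
rewrite !split// -ge0_integralD//.
- by apply: eq_integral => w _; rewrite (tail_integral_renewal lam_gt0 (a_law _)).
- by move=> w _; exact: integral_ge0.
- exact: measurable_split.
- by move=> w _; exact: integral_ge0.
- exact: measurable_split.
Qed.


(** A job that arrives at [z] and stays [x] units of time is there at time [t]. *)
Definition covers (t z x : R) : bool := (z <= t < z + x)%R.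

(** The probability that a job arrived at [z] is there at time [t], when every job
    is served at once. *)
Definition stay_prob (t z : R) : \bar R :=
  \int[P]_w (if covers t z (S w) then 1 else 0).

Lemma stay_prob_ge0 t z : 0 <= stay_prob t z.
Proof. by apply: integral_ge0 => w _; case: ifP. Qed.

Lemma measurable_covers d' (U : measurableType d') t (f g : U -> R) :
  measurable_fun [set: U] f -> measurable_fun [set: U] g ->
  measurable_fun [set: U] (fun u => covers t (f u) (g u)).
Proof.
move=> mf mg; apply: measurable_and; first exact: measurable_fun_ler.
by apply: measurable_fun_ltr => //; exact: measurable_funD.
Qed.

Let measurable_ind d' (U : measurableType d') (b : U -> bool) :
  measurable_fun [set: U] b ->
  measurable_fun [set: U] (fun u => if b u then 1 else 0 : \bar R).
Proof. by move=> mb; exact: measurable_fun_ifT. Qed.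

Lemma measurable_stay_prob t : measurable_fun [set: R] (stay_prob t).
Proof.
apply: (measurable_fun_fubini_tonelli_F (m2 := P)
  (fun p : R * T => if covers t p.1 (S p.2) then 1 else 0)); last first.
  by move=> p; case: ifP.
apply: measurable_ind; apply: measurable_covers => //.
exact: (measurableT_comp (@measurable_funPT _ _ _ _ S)).
Qed.

(** By Fubini, the arrival time is integrated first, for a fixed service time. *)
Lemma tail_integral_stay_prob t y : tail_integral lam (stay_prob t) y =
  \int[P]_w (lam%:E *
    \int[mu]_z (if (y <= z)%R && covers t z (S w) then 1 else 0)).
Proof.
have mS : measurable_fun [set: T] S by exact: measurable_funPT.
pose g (p : R * T) : \bar R :=
  if (y <= p.1)%R && covers t p.1 (S p.2) then 1 else 0.
have mg : measurable_fun [set: R * T] g.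
  apply: measurable_ind; apply: measurable_and; first exact: measurable_fun_ler.
  by apply: measurable_covers => //; exact: measurableT_comp.
have g0 p : 0 <= g p by rewrite /g; case: ifP.
rewrite ge0_integralZl//; last 3 first.
- exact: (measurable_fun_fubini_tonelli_G (m1 := mu) g).
- by move=> w _; apply: integral_ge0 => z _; exact: (g0 (z, w)).
- by rewrite lee_fin ltW.
rewrite -(fubini_tonelli (m1 := mu) (m2 := P) g)// -ge0_integralZl//; last 3 first.
- exact: (measurable_fun_fubini_tonelli_F (m2 := P) g).
- by move=> z _; apply: integral_ge0.
- by rewrite lee_fin ltW.
apply: eq_integral => z _; rewrite /g/=; case: (leP y z) => //= _.
by rewrite integral0 mule0.
Qed.

Hypothesis S_ge0 : {ae P, forall w, (0 <= S w)%R}.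

Lemma integral_service_pos : \int[P]_w (Num.max (S w) 0)%:E = 'E_P[S].
Proof.
rewrite expectation_def; apply: ae_eq_integral => //.
- apply/measurable_EFinP; apply: measurable_maxr => //; exact: measurable_funPT.
- by apply/measurable_EFinP; exact: measurable_funPT.
- by apply: filterS S_ge0 => w S0 _; rewrite max_l.
Qed.

Let covers_itv t z x : covers t z x = (z \in `](t - x)%R, t]).
Proof. by rewrite /covers in_itv/= ltrBlDr andbC. Qed.

(** The arrival times from which a job is there at time [t] form an interval that
    ends at [t] and whose length is the service time. *)
Lemma tail_integral_stay_prob_le t y :
  tail_integral lam (stay_prob t) y <= if (y <= t)%R then lam%:E * 'E_P[S] else 0.
Proof.
have mS : measurable_fun [set: T] S by exact: measurable_funPT.
rewrite tail_integral_stay_prob; case: ifPn => [_|]; last first.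
  rewrite -ltNge => ty; rewrite integral0_eq// => w _.
  rewrite integral0_eq ?mule0// => z _; rewrite /covers.
  by case: (leP y z) => //= yz; rewrite leNgt (lt_le_trans ty yz).
rewrite -integral_service_pos -ge0_integralZl//; last 3 first.
- by apply/measurable_EFinP; apply: measurable_maxr.
- by move=> w _; rewrite lee_fin le_max lexx orbT.
- by rewrite lee_fin ltW.
apply: ge0_le_integral_lower => w.
  apply: mule_ge0; first by rewrite lee_fin ltW.
  by apply: integral_ge0 => z _; case: ifP.
apply: lee_wpmul2l; first by rewrite lee_fin ltW.
apply: (@le_trans _ _ (\int[mu]_(z in `](t - S w)%R, t]) 1)).
  rewrite [leRHS]integral_mkcond; apply: ge0_le_integral_lower => z.
    by case: ifP.
  rewrite patchE mem_setE -covers_itv.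
  by case: covers; rewrite ?andbF// andbT; case: ifP.
rewrite integral_cst//= mul1e lebesgue_measure_itv/= lte_fin.
case: ifP => _; last by rewrite lee_fin le_max lexx orbT.
by rewrite -EFinB lee_fin opprB addrC subrK le_max lexx.
Qed.

Lemma tail_integral_stay_prob_ge t : (0 <= t)%R ->
  lam%:E * \int[P]_w (Num.max (Num.min (S w) t) 0)%:E <=
  tail_integral lam (stay_prob t) 0.
Proof.
have mS : measurable_fun [set: T] S by exact: measurable_funPT.
move=> t0; rewrite tail_integral_stay_prob -ge0_integralZl//; last 3 first.
- apply/measurable_EFinP; apply: measurable_maxr => //.
  exact: measurable_minr.
- by move=> w _; rewrite lee_fin le_max lexx orbT.
- by rewrite lee_fin ltW.
apply: ge0_le_integral_lower => w.
  by apply: mule_ge0; rewrite lee_fin ?(ltW lam_gt0)// le_max lexx orbT.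
apply: lee_wpmul2l; first by rewrite lee_fin ltW.
apply: (@le_trans _ _ (\int[mu]_(z in `](Num.max 0 (t - S w))%R, t]) 1)).
  rewrite integral_cst//= mul1e lebesgue_measure_itv/= lte_fin.
  have len : (Num.max (Num.min (S w) t) 0 <=
      (if Num.max 0 (t - S w) < t then t - Num.max 0 (t - S w) else 0))%R.
    rewrite /Num.max /Num.min.
    case: (ltP (S w) t) => St; case: (ltP (0%R : R) (t - S w)%R) => tS;
      case: (ltP _ t) => ht; case: ltP => ?; lra.
  by move: len; case: ifP.
rewrite [leLHS]integral_mkcond; apply: ge0_le_integral_lower => z.
  by rewrite patchE; case: ifP.
rewrite patchE mem_setE covers_itv !in_itv/= gt_max.
case: (ltP 0%R z) => //= z0; last by case: ifP.
by rewrite (ltW z0)/=; case: ifP.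
Qed.

Lemma integral_service_law (h : R -> \bar R) k :
  measurable_fun [set: R] h -> (forall x, 0 <= h x) ->
  \int[P]_w h (s k w) = \int[P]_w h (S w).
Proof.
move=> mh h0.
rewrite -[LHS](ge0_integral_distribution (s k))//.
rewrite -[RHS](ge0_integral_distribution S)//.
by apply: eq_measure_integral => A mA _; exact: s_law.
Qed.

Lemma integral_covers (J : set (nat + nat)) (U : T -> R) (h : R -> \bar R) t k :
  depends_on input J U -> ~ J (inr k) ->
  measurable_fun [set: R] h -> (forall x, 0 <= h x) ->
  \int[P]_w (if covers t (U w) (s k w) then h (U w) else 0) =
  \int[P]_w (stay_prob t (U w) * h (U w)).
Proof.
move=> JU Jk mh h0.
have mU := depends_on_measurable JU.
have indep : independent_pair P U (s k).
  apply: (mutually_independent_blocks (K := [set inr k]) input_indep _ JU).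
    by rewrite -subset0 => i [Ji /= iE]; apply: Jk; rewrite -iE.
  exact: (depends_on_coord (i := inr k)).
rewrite (integral_independent_pair (h := fun p : R * R =>
   if covers t p.1 p.2 then h p.1 else 0) mU _ indep)//; last 2 first.
- apply: measurable_fun_ifT => //; first exact: measurable_covers.
  exact: measurableT_comp.
- by move=> p; case: ifP.
apply: eq_integral => w _.
rewrite (integral_service_law (h := fun x => if covers t (U w) x then h (U w) else 0))/=; last 2 first.
- apply: measurable_fun_ifT => //; exact: measurable_covers.
- by move=> x; case: ifP.
have mS : measurable_fun [set: T] S by exact: measurable_funPT.
rewrite muleC -ge0_integralZl//.
- by apply: eq_integral => w' _; case: ifP; rewrite ?mule1 ?mule0.
- by apply: measurable_ind; exact: measurable_covers.
- by move=> w' _; case: ifP.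
Qed.

Lemma measurable_arrived t o m :
  measurable [set w | (partial_sum o m w <= t)%R].
Proof.
rewrite -[X in measurable X]setTI.
have := measurable_partial_sum o m.
move=> /(_ measurableT `]-oo, t]%classic (measurable_itv _)).
by congr (measurable (_ `&` _)); apply/seteqP; split => w /=; rewrite in_itv.
Qed.

(** The mean number of arrivals up to [t]: [renewal_sum] for the indicator of
    ]-oo, t]. *)
Lemma sum_arrival_prob_le t N : (0 <= t)%R ->
  \sum_(m < N) P [set w | (partial_sum 0 m.+1 w <= t)%R] <= (lam * t)%:E.
Proof.
move=> t0; pose f (z : R) : \bar R := if (z <= t)%R then 1 else 0.
have mf : measurable_fun [set: R] f.
  by apply: measurable_ind; exact: measurable_fun_ler.
have f0 z : 0 <= f z by rewrite /f; case: ifP.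
have -> : (lam * t)%:E = tail_integral lam f 0.
  transitivity (\int[mu]_(z in `[0%R, t]) lam%:E).
    by rewrite integral_cst//= lebesgue_measure_itv/= lte_fin EFinM; case: ltgtP t0 => // <- _;
      rewrite ?oppr0 ?addr0.
  rewrite integral_mkcond; apply: eq_integral => z _.
  rewrite patchE mem_setE in_itv/= /f.
  by case: (leP 0%R z) => //= _; case: ifP; rewrite ?mule1 ?mule0.
rewrite -(renewal_sum 0 N 0 mf f0); apply: (@le_trans _ _
    (\sum_(m < N) \int[P]_w f (0 + partial_sum 0 m.+1 w)%R)); last first.
  rewrite leeDl//; apply: integral_ge0 => w _.
  exact: (tail_integral_ge0 lam_gt0 f0).
apply: lee_sum => m _; rewrite le_eqVlt; apply/orP; left; apply/eqP.
have mE := measurable_arrived t 0 m.+1.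
rewrite -[X in P X]setIT -integral_indic//; apply: eq_integral => w _.
rewrite indicE /f add0r; case: ifPn => wt.
  by rewrite mem_set.
by rewrite memNset//; exact/negP.
Qed.

Lemma integral_arrived_service (g : R -> \bar R) t k :
  measurable_fun [set: R] g -> (forall x, 0 <= g x) ->
  \int[P]_w (if (partial_sum 0 k.+1 w <= t)%R then g (s k w) else 0) =
  P [set w | (partial_sum 0 k.+1 w <= t)%R] * \int[P]_w g (S w).
Proof.
move=> mg g0; have mpart := measurable_partial_sum 0 k.+1.
have indep : independent_pair P (partial_sum 0 k.+1) (s k).
  apply: (mutually_independent_blocks (J := arrivals 0 k.+1)
     (K := [set inr k]) input_indep).
  - by rewrite -subset0 => i [[j _ ->]].
  - exact: depends_on_partial_sum.
  - exact: (depends_on_coord (i := inr k)).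
rewrite (integral_independent_pair (h := fun p : R * R =>
   if (p.1 <= t)%R then g p.2 else 0) mpart _ indep)//; last 2 first.
- apply: measurable_fun_ifT => //; first exact: measurable_fun_ler.
  exact: measurableT_comp.
- by move=> p; case: ifP.
have mE := measurable_arrived t 0 k.+1.
have Ig0 : 0 <= \int[P]_w g (S w) by exact: integral_ge0.
rewrite muleC -[X in _ * P X]setIT -integral_indic// -ge0_integralZl//; last first.
- by apply/measurable_EFinP; exact: measurable_indic.
apply: eq_integral => w _; rewrite /= indicE.
have [wt|wt] := boolP (partial_sum 0 k.+1 w <= t)%R.
  by rewrite mem_set// mule1 integral_service_law.
by rewrite memNset ?mule0 ?integral0//; exact/negP.
Qed.

Hypothesis ES_fin : 'E_P[S] < +oo.

Lemma stay_sum_le t N :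
  \sum_(k < N) \int[P]_w stay_prob t (partial_sum 0 k.+1 w) <= lam%:E * 'E_P[S].
Proof.
have ES0 : 0 <= 'E_P[S].
  rewrite -integral_service_pos; apply: integral_ge0 => w _.
  by rewrite lee_fin le_max lexx orbT.
have tl : tail_integral lam (stay_prob t) 0 <= lam%:E * 'E_P[S].
  apply: (le_trans (tail_integral_stay_prob_le _ _)); case: ifP => // _.
  by rewrite mule_ge0// lee_fin ltW.
apply: le_trans tl.
rewrite -(renewal_sum 0 N 0 (measurable_stay_prob t) (stay_prob_ge0 t)).
under [X in _ <= X + _]eq_bigr do under eq_integral do rewrite add0r.
rewrite leeDl//; apply: integral_ge0 => w _.
exact: (tail_integral_ge0 lam_gt0 (stay_prob_ge0 t)).
Qed.


Let ES_ge0 : 0 <= 'E_P[S].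
Proof.
rewrite -integral_service_pos; apply: integral_ge0 => w _.
by rewrite lee_fin le_max lexx orbT.
Qed.

Hypothesis ES_gt0 : 0 < 'E_P[S].

Let ESK : (fine 'E_P[S])%:E = 'E_P[S].
Proof. by rewrite fineK// ge0_fin_numE. Qed.

(** These probabilities have a finite sum over [N]. *)
Lemma late_arrival_small t eps : (0 <= t)%R -> (0 < eps)%R ->
  exists N, P [set w | (partial_sum 0 N.+1 w <= t)%R] <= eps%:E.
Proof.
move=> t0 eps0; apply: contrapT => /forallNP H.
have [M hM] : exists M : nat, (lam * t < eps * M%:R)%R.
  exists (Num.truncn (lam * t / eps)).+1; rewrite [(eps * _)%R]mulrC -ltr_pdivrMr//.
  by rewrite truncnS_gt.
have := sum_arrival_prob_le M t0; rewrite leNgt => /negP; apply.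
apply: (@lt_le_trans _ _ (\sum_(m < M) eps%:E)).
  by rewrite sumEFin lte_fin sumr_const card_ord -mulr_natr.
by apply: lee_sum => m _; have /negP := H m; rewrite -ltNge => /ltW.
Qed.

Let truncation_le (x t u : R) : (t <= u)%R ->
  (Num.max (Num.min x t) 0 <= Num.max (Num.min x u) 0)%R.
Proof.
move=> tu; rewrite /Num.max /Num.min.
by case: (ltP x t); case: (ltP x u) => ? ?; case: ltP => ?; case: ltP => ?; lra.
Qed.

Lemma truncated_service_mean eps : (0 < eps)%R -> exists t0 : R, (0 <= t0)%R /\
  forall t, (t0 <= t)%R -> 'E_P[S] <= \int[P]_w (Num.max (Num.min (S w) t) 0)%:E + eps%:E.
Proof.
move=> eps0.
have mS : measurable_fun [set: T] S by exact: measurable_funPT.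
pose g (n : nat) (w : T) : \bar R := (Num.max (Num.min (S w) n%:R) 0)%:E.
have mg n : measurable_fun [set: T] (g n).
  apply/measurable_EFinP; apply: measurable_maxr => //; exact: measurable_minr.
have g0 n w : 0 <= g n w by rewrite lee_fin le_max lexx orbT.
have ndg w : nondecreasing_seq (g ^~ w).
  by move=> m n mn; rewrite lee_fin truncation_le// ler_nat.
have lim_g w : limn (g ^~ w) = (Num.max (S w) 0)%:E.
  apply/cvg_lim => //; apply: cvg_near_cst; near=> n.
  rewrite /g min_l//; near: n; exact: nbhs_infty_ger.
have := @cvg_monotone_convergence _ _ _ P _ measurableT g mg
  (fun n w _ => g0 n w) (fun w _ => ndg w).
rewrite (eq_integral (fun w => (Num.max (S w) 0)%:E)); last by move=> w _; exact: lim_g.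
rewrite integral_service_pos -ESK => /fine_cvgP [fin /cvgrPdist_le /(_ _ eps0)] near_n.
near \oo => n.
have finn : \int[P]_w g n w \is a fin_num by near: n.
have : (`|fine 'E_P[S] - fine (\int[P]_w g n w)| <= eps)%R by near: n.
move=> /ler_normlW; rewrite lerBlDr => hn.
exists n%:R; split => // t nt; apply: (@le_trans _ _ (\int[P]_w g n w + eps%:E)).
  by rewrite -(fineK finn) -EFinD lee_fin addrC.
rewrite leeD2r//; apply: ge0_le_integral_lower => // w.
by rewrite lee_fin truncation_le.
Unshelve. all: by end_near. Qed.

(** The remainder of [renewal_sum] is at most [lam * E[S]] times the probability
    that the [N]-th arrival precedes [t], since no job arriving after [t] is there
    at [t]; and the total integral is [lam * E[min(S, t)]], which tends to
    [lam * E[S]]. *)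
Lemma stay_sum_ge eps : (0 < eps)%R -> exists t0 : R, forall t, (t0 <= t)%R ->
  exists N, lam%:E * 'E_P[S] <=
    \sum_(k < N) \int[P]_w stay_prob t (partial_sum 0 k.+1 w) + eps%:E.
Proof.
move=> eps0; have lam0 : 0 <= lam%:E by rewrite lee_fin ltW.
pose e := fine 'E_P[S]; have e0 : (0 <= e)%R by exact: fine_ge0.
have eps1_gt0 : (0 < eps / 2 / lam)%R by rewrite !divr_gt0.
have [t0 [t0_ge0 ht0]] := truncated_service_mean eps1_gt0.
have le_gt0 : (0 < lam * e + 1)%R by rewrite ltr_wpDl// mulr_ge0// ltW.
have eps2_gt0 : (0 < eps / 2 / (lam * e + 1))%R by rewrite !divr_gt0.
exists t0 => t t0t; have t_ge0 : (0 <= t)%R := le_trans t0_ge0 t0t.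
have [M hM] := late_arrival_small t_ge0 eps2_gt0.
exists M.+1.
have rem : \int[P]_w tail_integral lam (stay_prob t) (0 + partial_sum 0 M.+1 w)%R <=
    (eps / 2)%:E.
  apply: (@le_trans _ _ (\int[P]_w (lam%:E * 'E_P[S] *
      (\1_[set w | (partial_sum 0 M.+1 w <= t)%R] w)%:E))).
    apply: ge0_le_integral_lower => w.
      exact: (tail_integral_ge0 lam_gt0 (stay_prob_ge0 t)).
    apply: (le_trans (tail_integral_stay_prob_le _ _)); rewrite add0r indicE.
    case: ifPn => wt; first by rewrite mem_set// mule1.
    by rewrite memNset ?mule0//; exact/negP.
  have mE := measurable_arrived t 0 M.+1.
  rewrite ge0_integralZl//; last 2 first.
  - by apply/measurable_EFinP; exact: measurable_indic.
  - exact: mule_ge0.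
  rewrite integral_indic// setIT -ESK -EFinM.
  apply: (le_trans (lee_wpmul2l _ hM)); first by rewrite lee_fin mulr_ge0// ltW.
  rewrite -EFinM lee_fin mulrCA -ler_pdivlMl ?divr_gt0//.
  by rewrite mulVf ?gt_eqF ?divr_gt0// ler_pdivrMr// mul1r lerDl.
apply: (@le_trans _ _ (tail_integral lam (stay_prob t) 0 + (eps / 2)%:E)).
  apply: (@le_trans _ _ (lam%:E *
      (\int[P]_w (Num.max (Num.min (S w) t) 0)%:E + (eps / 2 / lam)%:E))).
    by rewrite lee_wpmul2l// ht0.
  rewrite ge0_muleDr//; last 2 first.
  - by apply: integral_ge0 => w _; rewrite lee_fin le_max lexx orbT.
  - by rewrite lee_fin !divr_ge0// ltW.
  rewrite -EFinM [(lam * _)%R]mulrC divfK ?gt_eqF// leeD2r//.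
  exact: tail_integral_stay_prob_ge.
rewrite -(renewal_sum 0 M.+1 0 (measurable_stay_prob t) (stay_prob_ge0 t)).
under [X in X + _ + _ <= _]eq_bigr do under eq_integral do rewrite add0r.
by rewrite -addeA leeD2l// (le_trans (leeD2r _ rem))// -EFinD lee_fin -splitr.
Qed.

Let measurable_s k : measurable_fun [set: T] (s k).
Proof. exact: measurable_funPT. Qed.

Definition present (t : R) (k : nat) (w : T) : bool :=
  covers t (partial_sum 0 k.+1 w) (s k w).

Lemma measurable_present t k : measurable_fun [set: T] (present t k).
Proof. by apply: measurable_covers => //; exact: measurable_partial_sum. Qed.

Lemma integral_present t k :
  \int[P]_w (if present t k w then 1 else 0) =
  \int[P]_w stay_prob t (partial_sum 0 k.+1 w).
Proof.
rewrite (integral_covers (J := arrivals 0 k.+1) (h := cst 1) t (k := k))//.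
- by apply: eq_integral => w _; rewrite mule1.
- exact: depends_on_partial_sum.
- by case.
Qed.

(** The inter-arrival times between job [j] and a later job, and the service time
    of the later one, are independent of the arrival and service of job [j]. *)
Lemma integral_present_pair t j m :
  \int[P]_w (if present t j w && present t (j.+1 + m) w then 1 else 0) =
  \int[P]_w (if present t j w then
    \int[P]_w' stay_prob t (partial_sum 0 j.+1 w + partial_sum j.+1 m.+1 w')%R
    else 0).
Proof.
set k := (j.+1 + m)%N.
pose J := arrivals 0 j.+1 `|` [set inr j].
pose K := arrivals j.+1 m.+1 `|` [set inr k].
have JU : depends_on input J (fun w => (partial_sum 0 j.+1 w, s j w)).
  apply: measurable_fun_pair.
    by apply: depends_on_partial_sum => i ?; left.
  by apply: (depends_on_coord (i := inr j)); right.
have KV : depends_on input K (fun w => (partial_sum j.+1 m.+1 w, s k w)).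
  apply: measurable_fun_pair.
    by apply: depends_on_partial_sum => i ?; left.
  by apply: (depends_on_coord (i := inr k)); right.
have JK : J `&` K = set0.
  rewrite -subset0 => i [[[i1 /andP[_ i1j] ->]|/= ->]] [[i2 /andP[i2j _]]|] //=.
  - by case=> E; rewrite E ltnNge i2j in i1j.
  - by case=> E; have := leq_addr m j.+1; rewrite -/k -E ltnn.
have indep := mutually_independent_blocks input_indep JK JU KV.
pose h (p : (R * R) * (R * R)) : \bar R :=
  if covers t p.1.1 p.1.2 && covers t (p.1.1 + p.2.1) p.2.2 then 1 else 0.
have mh : measurable_fun [set: (R * R) * (R * R)] h.
  apply: measurable_ind; apply: measurable_and; apply: measurable_covers.
  - exact: (measurableT_comp measurable_fst).
  - exact: (measurableT_comp measurable_snd).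
  - apply: measurable_funD.
      exact: (measurableT_comp measurable_fst).
    exact: (measurableT_comp measurable_fst).
  - exact: (measurableT_comp measurable_snd).
have h0 p : 0 <= h p by rewrite /h; case: ifP.
have sumE w : (partial_sum 0 k.+1 w =
    partial_sum 0 j.+1 w + partial_sum j.+1 m.+1 w)%R.
  rewrite /partial_sum /k -addnS big_split_ord/=.
  by congr (_ + _)%R; apply: eq_bigr => i _; rewrite !add0n.
transitivity (\int[P]_w h ((partial_sum 0 j.+1 w, s j w),
                           (partial_sum j.+1 m.+1 w, s k w))).
  by apply: eq_integral => w _; rewrite /h/= -sumE.
rewrite (integral_independent_pair _ _ indep mh h0); last 2 first.
- exact: (depends_on_measurable JU).
- exact: (depends_on_measurable KV).
apply: eq_integral => w _; rewrite /h/= -/(present t j w).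
case: ifP => _ /=; last by rewrite integral0.
set z := partial_sum 0 j.+1 w.
rewrite (integral_covers (J := arrivals j.+1 m.+1) (h := cst 1)
   (U := fun w' => (z + partial_sum j.+1 m.+1 w')%R) t (k := k))//.
- by apply: eq_integral => w' _; rewrite mule1.
- by apply: measurable_funD => //; exact: depends_on_partial_sum.
- by case.
Qed.

(** For a fixed job [j], summing over the later jobs with [renewal_sum] gives at
    most the tail integral from the arrival of [j]; summing over [j] in the same
    way leaves the integral of [stay_prob] against its own tail, which is half of
    a square by [tail_integral_square]. *)
Lemma pair_sum_le t N :
  \sum_(j < N) \sum_(m < N - j.+1)
    \int[P]_w (if present t j w && present t (j.+1 + m) w then 1 else 0) +
  \sum_(j < N) \sum_(m < N - j.+1)
    \int[P]_w (if present t j w && present t (j.+1 + m) w then 1 else 0)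
  <= (lam%:E * 'E_P[S]) * (lam%:E * 'E_P[S]).
Proof.
have mG := measurable_stay_prob t; have G0 := stay_prob_ge0 t.
have mH := measurable_tail_integral lam_gt0 mG G0.
have H0 := tail_integral_ge0 lam_gt0 G0.
have mGH : measurable_fun [set: R]
    (fun z => stay_prob t z * tail_integral lam (stay_prob t) z).
  exact: emeasurable_funM.
have GH0 z : 0 <= stay_prob t z * tail_integral lam (stay_prob t) z.
  exact: mule_ge0.
have le1 : \sum_(j < N) \sum_(m < N - j.+1)
    \int[P]_w (if present t j w && present t (j.+1 + m) w then 1 else 0) <=
    tail_integral lam (fun z => stay_prob t z * tail_integral lam (stay_prob t) z) 0.
  rewrite -(renewal_sum 0 N 0 mGH GH0).
  apply: (@le_trans _ _ (\sum_(j < N) \int[P]_w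
     (stay_prob t (0 + partial_sum 0 j.+1 w)%R *
      tail_integral lam (stay_prob t) (0 + partial_sum 0 j.+1 w)%R))); last first.
    rewrite leeDl//; apply: integral_ge0 => w _.
    exact: (tail_integral_ge0 lam_gt0 GH0).
  apply: lee_sum => j _.
  under [leRHS]eq_integral do rewrite add0r.
  rewrite -(integral_covers (J := arrivals 0 j.+1) t (k := j))//; last 2 first.
  - exact: depends_on_partial_sum.
  - by case.
  under eq_bigr do rewrite integral_present_pair.
  apply: (le_trans (ge0_integral_sum_lower _ _ _)) => [m w|].
    by case: ifP => // _; apply: integral_ge0.
  apply: ge0_le_integral_lower => w.
    by apply: sume_ge0 => m _; case: ifP => // _; apply: integral_ge0.
  rewrite -/(present t j w); case: ifP => _; last by rewrite big1.
  rewrite -(renewal_sum j.+1 (N - j.+1) (partial_sum 0 j.+1 w) mG G0).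
  by rewrite leeDl//; apply: integral_ge0 => w' _.
apply: (le_trans (leeD le1 le1)).
rewrite (tail_integral_square lam_gt0 mG G0).
have tl : tail_integral lam (stay_prob t) 0 <= lam%:E * 'E_P[S].
  apply: (le_trans (tail_integral_stay_prob_le _ _)); case: ifP => // _.
  by rewrite mule_ge0// lee_fin ltW.
by apply: lee_pmul.
Qed.


(** Truncated to the first [N] jobs, so that moments are finite sums. *)
Definition number_present (t : R) (N : nat) (w : T) : R :=
  (\sum_(k < N) (present t k w)%:R)%R.

Let present_indicE (b : bool) : (b%:R)%:E = (if b then 1 else 0) :> \bar R.
Proof. by case: b. Qed.

Lemma measurable_number_present t N : measurable_fun [set: T] (number_present t N).
Proof.
apply: measurable_sum => k; apply/measurable_EFinP.
rewrite (_ : _ \o _ = (fun w => if present t k w then 1 else 0)).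
  by apply: measurable_ind; exact: measurable_present.
by apply/funext => w /=; rewrite present_indicE.
Qed.

Lemma number_present_ge0 t N w : (0 <= number_present t N w)%R.
Proof. exact: sumr_ge0. Qed.

Lemma number_present_mean t N : \int[P]_w (number_present t N w)%:E =
  \sum_(k < N) \int[P]_w stay_prob t (partial_sum 0 k.+1 w).
Proof.
under eq_bigr do rewrite -integral_present.
rewrite -ge0_integral_sum//.
- apply: eq_integral => w _; rewrite -sumEFin.
  by apply: eq_bigr => k _; rewrite present_indicE.
- by move=> k; apply: measurable_ind; exact: measurable_present.
- by move=> k w _; case: ifP.
Qed.

Lemma number_present_second_moment t N :
  \int[P]_w (number_present t N w ^+ 2)%:E <=
  lam%:E * 'E_P[S] + (lam%:E * 'E_P[S]) * (lam%:E * 'E_P[S]).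
Proof.
pose pair (j m : nat) (w : T) : \bar R :=
  if present t j w && present t (j.+1 + m) w then 1 else 0.
have mpair j m : measurable_fun [set: T] (pair j m).
  by apply: measurable_ind; apply: measurable_and; exact: measurable_present.
have pair0 j m w : 0 <= pair j m w by rewrite /pair; case: ifP.
pose pairs (w : T) : \bar R := \sum_(j < N) \sum_(m < N - j.+1) pair j m w.
have mpairs : measurable_fun [set: T] pairs.
  by apply: emeasurable_sum => j; apply: emeasurable_sum.
have pairs0 w : 0 <= pairs w by apply: sume_ge0 => j _; apply: sume_ge0.
have pairsE : \int[P]_w pairs w =
    \sum_(j < N) \sum_(m < N - j.+1) \int[P]_w pair j m w.
  rewrite ge0_integral_sum//.
  - by apply: eq_bigr => j _; rewrite ge0_integral_sum.
  - by move=> j; apply: emeasurable_sum.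
  - by move=> j w _; apply: sume_ge0.
rewrite (eq_integral (fun w => (number_present t N w)%:E + (pairs w + pairs w))); last first.
  move=> w _; rewrite /number_present (@sqr_sum_bool R (fun k => present t k w)) EFinD mulr2n EFinD.
  suff -> : pairs w = (\sum_(j < N) \sum_(m < N - j.+1)
      (present t j w && present t (j.+1 + m)%N w)%:R)%:E by [].
  rewrite -sumEFin; apply: eq_bigr => j _; rewrite -sumEFin.
  by apply: eq_bigr => m _; rewrite present_indicE.
rewrite ge0_integralD//; last 4 first.
- by move=> w _; rewrite lee_fin number_present_ge0.
- by apply/measurable_EFinP; exact: measurable_number_present.
- by move=> w _; exact: adde_ge0.
- exact: emeasurable_funD.
rewrite ge0_integralD// number_present_mean pairsE.
by apply: leeD; [exact: stay_sum_le|exact: pair_sum_le].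
Qed.

(** With r = sqrt c, the positive part is bounded by a polynomial of degree two:
    (c - y)^+ <= (c - y) / 2 + (c - y)^2 / (4 r) + r / 4.  For a mean within eps'
    of c and a second moment at most c + c^2, the expectation of the right-hand
    side is at most r / 2 up to a multiple of eps'. *)
Lemma deficit_mean_le eps : (0 < eps)%R -> exists t0 : R, forall t, (t0 <= t)%R ->
  exists N, \int[P]_w (Num.max (lam * fine 'E_P[S] - number_present t N w) 0)%:E <=
    (Num.sqrt (lam * fine 'E_P[S]) / 2 + eps)%:E.
Proof.
move=> eps0; set c := (lam * fine 'E_P[S])%R; set r := Num.sqrt c.
have cE : lam%:E * 'E_P[S] = c%:E by rewrite /c EFinM ESK.
have c_gt0 : (0 < c)%R by rewrite -lte_fin -cE mule_gt0.
have r_gt0 : (0 < r)%R by rewrite sqrtr_gt0.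
have rr : (r * r = c)%R by rewrite -expr2 sqr_sqrtr// ltW.
pose eps' := (eps / (2^-1 + r / 2))%R.
have den_gt0 : (0 < 2^-1 + r / 2 :> R)%R by rewrite addr_gt0// divr_gt0.
have eps'0 : (0 < eps')%R by rewrite divr_gt0.
have [t0 ht0] := stay_sum_ge eps'0.
exists t0 => t /ht0 [N hN]; exists N.
set y := number_present t N.
have my : measurable_fun [set: T] y := measurable_number_present t N.
have y0 w : (0 <= y w)%R := number_present_ge0 t N w.
have mean_le : \int[P]_w (y w)%:E <= c%:E.
  by rewrite number_present_mean -cE; exact: stay_sum_le.
have mean_ge : c%:E <= \int[P]_w (y w)%:E + eps'%:E.
  by rewrite number_present_mean -cE.
have sq_le : \int[P]_w (y w ^+ 2)%:E <= (c + c * c)%:E.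
  by rewrite EFinD [(c * c)%:E]EFinM -cE; exact: number_present_second_moment.
pose p (w : T) : R := (Num.max (c - y w) 0)%R.
have p0 w : (0 <= p w)%R by rewrite le_max lexx orbT.
have mp : measurable_fun [set: T] p.
  by apply: measurable_maxr => //; exact: measurable_funB.
pose al : R := (2^-1 + r / 2)%R; pose be : R := (4 * r)^-1%R.
pose ga : R := (c / 2 + c * c / (4 * r) + r / 4)%R.
have al0 : (0 <= al)%R by exact: ltW.
have be0 : (0 <= be)%R by rewrite invr_ge0 mulr_ge0// ltW.
have ga0 : (0 <= ga)%R.
  have c0 := ltW c_gt0; have r0 := ltW r_gt0.
  rewrite /ga; apply: addr_ge0; [apply: addr_ge0|]; apply: divr_ge0 => //.
    exact: mulr_ge0.
  exact: mulr_ge0.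
(* The terms are distributed so that both sides are nonnegative and integrate
   without subtraction. *)
have pointwise w : (p w + al * y w <= be * y w ^+ 2 + ga)%R.
  have key : (be * y w ^+ 2 + ga - (p w + al * y w) =
     be * (`|c - y w| - r) ^+ 2)%R.
    have r_neq0 : r != 0%R by rewrite gt_eqF.
    rewrite /p /al /be /ga -rr.
    have [d0|d0] := leP 0%R (r * r - y w)%R.
      by rewrite (ger0_norm d0); field.
    by rewrite (ltr0_norm d0); field.
  by rewrite -subr_ge0 key mulr_ge0// sqr_ge0.
have int_le : \int[P]_w (p w)%:E + al%:E * \int[P]_w (y w)%:E <=
    be%:E * \int[P]_w (y w ^+ 2)%:E + ga%:E.
  have mEy : measurable_fun [set: T] (fun w => (y w)%:E) by exact/measurable_EFinP.
  rewrite -ge0_integralZl; [|exact: measurableT|exact: mEy|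
    by move=> w _; rewrite lee_fin|by rewrite lee_fin].
  rewrite -ge0_integralD//; last 4 first.
  - by move=> w _; rewrite lee_fin.
  - exact/measurable_EFinP.
  - by move=> w _; rewrite mule_ge0 ?lee_fin.
  - exact: measurable_funeM.
  have msq : measurable_fun [set: T] (fun w => (y w ^+ 2)%:E).
    by apply/measurable_EFinP; exact: measurable_funX.
  apply: (@le_trans _ _ (\int[P]_w (be%:E * (y w ^+ 2)%:E + ga%:E))).
    apply: ge0_le_integral_lower => w.
      by rewrite adde_ge0 ?mule_ge0 ?lee_fin.
    by rewrite -!EFinM -!EFinD lee_fin.
  rewrite ge0_integralD; [|exact: measurableT|
    by move=> w _; rewrite mule_ge0 ?lee_fin// sqr_ge0|exact: measurable_funeM|
    by move=> w _; rewrite lee_fin|exact: measurable_cst].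
  rewrite ge0_integralZl; [|exact: measurableT|exact: msq|
    by move=> w _; rewrite lee_fin sqr_ge0|by rewrite lee_fin].
  by rewrite (integral_cst P measurableT) leeD2l// [X in _ * X](_ : _ = 1) ?mule1//;
    exact: probability_setT.
have fin_mean : \int[P]_w (y w)%:E \is a fin_num.
  rewrite ge0_fin_numE; first by rewrite (le_lt_trans mean_le)// ltry.
  by apply: integral_ge0 => w _; rewrite lee_fin.
have : \int[P]_w (p w)%:E + (al * (c - eps'))%:E <= (be * (c + c * c) + ga)%:E.
  apply: le_trans (le_trans int_le _).
    rewrite leeD2l// EFinM lee_wpmul2l ?lee_fin// EFinB leeBlDr//.
  rewrite -[leRHS]/(be%:E * (c + c * c)%:E + ga%:E).
  by rewrite leeD2r// lee_wpmul2l ?lee_fin.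
rewrite -leeBrDr// -EFinB => /le_trans; apply; rewrite lee_fin.
have -> : (al * (c - eps') = al * c - eps)%R.
  by rewrite mulrBr /eps' mulrC [(_ * (eps / _))%R]mulrC divfK ?gt_eqF.
have r_neq0 : r != 0%R by rewrite gt_eqF.
rewrite /al /be /ga -rr le_eqVlt; apply/orP; left; apply/eqP; by field.
Qed.

End poisson_arrivals.
(** * Sample paths of the queue *)

(** A half-open interval of length [x] contains at most [x / delta + 1] points of a
    grid of mesh [delta]. *)
Lemma grid_count (R : realFieldType) (delta b x : R) (L : nat) : 0 < delta ->
  (\sum_(i < L) (b <= i%:R * delta < b + x)%R)%N%:R * delta <= Num.max x 0 + delta.
Proof.
move=> d0; set c := fun L => (\sum_(i < L) (b <= i%:R * delta < b + x)%R)%N.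
have [x0|x0] := ltP x 0.
  rewrite /c big1 ?mul0r ?add0r ?ltW// => i _.
  by case: (boolP (b <= _ < _)) => // /andP[? ?]; exfalso; lra.
(* The first bound, on the part of the interval before the grid point [L], is what
   makes the induction for the second one work. *)
suff [] : (c L)%:R * delta <= Num.max 0 (L%:R * delta - b) /\
  (c L)%:R * delta <= x + delta by [].
elim: L => [|L [IH1 IH2]].
  by rewrite /c big_ord0 !mul0r le_max lexx; split=> //; rewrite addr_ge0// ltW.
have -> : (c L.+1)%:R * delta =
    (c L)%:R * delta + (b <= L%:R * delta < b + x)%R%:R * delta.
  by rewrite /c big_ord_recr/= natrD mulrDl.
have LE : L.+1%:R * delta = L%:R * delta + delta by rewrite -natr1 mulrDl mul1r.
rewrite LE; case: (leP b (L%:R * delta)) => bL /=; last first.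
  rewrite mul0r addr0; split => //; apply: le_trans IH1 _.
  by rewrite ge_max !le_max lexx/=; apply/orP; right; lra.
case: (ltP (L%:R * delta) (b + x)) => Lx /=; rewrite ?mul1r ?mul0r ?addr0.
  move: IH1; rewrite max_r ?subr_ge0// => IH1.
  by split; [rewrite le_max; apply/orP; right; lra|lra].
split => //; apply: le_trans IH1 _.
by rewrite ge_max !le_max lexx/=; apply/orP; right; lra.
Qed.

Section sample_path.
Context (R : realType) (n : nat).

Definition empty_state : initial_state R n :=
  @InitialState R n 0 [::] (esym (min0n n)) isT.

Context (a s : nat -> R).
Notation arr := (arrival empty_state a).
Notation dep := (departure empty_state a s).
Notation sta := (start empty_state a s).
Notation free := (free_times empty_state a s).

Lemma arrival_empty k : arr k = \sum_(i < k.+1) a i.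
Proof. by rewrite /arrival/= subn0. Qed.

Lemma service_empty k : service empty_state s k = s k.
Proof. by rewrite /service/= subn0. Qed.

Lemma arrival_le_start k : arr k <= sta k.
Proof. by rewrite le_max lexx. Qed.

(** A server that is free after [u] only is so because of the departure of the last
    job that was given to it. *)
Lemma count_free_times (u : R) k : 0 <= u ->
  (count (fun x => (u < x)%R) (free k) <= \sum_(j < k) (u < dep j)%R)%N.
Proof.
move=> u0; elim: k => [|k IHk].
  by rewrite /= count_nseq big_ord0 ltNge u0.
rewrite big_ord_recr/= (permP (permEl (perm_sort _ _))) /= addnC.
rewrite leq_add//; apply: leq_trans IHk.
by case: (free k) => //= x F; exact: leq_addl.
Qed.

Lemma size_free_times k : (0 < n)%N -> size (free k) = n.
Proof.
move=> n0; elim: k => [|k IHk] /=; first by rewrite size_nseq.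
by rewrite size_sort/= size_behead IHk prednK.
Qed.

Lemma sorted_free_times k : sorted <=%R (free k).
Proof.
case: k => [|k] /=; last by apply: sort_sorted; exact: le_total.
by case: n => //= m; elim: m => //= m ->; rewrite lexx.
Qed.

Lemma lt_head_count (u : R) k : u < head 0 (free k) ->
  count (fun x => (u < x)%R) (free k) = size (free k).
Proof.
have := sorted_free_times k; case: (free k) => //= x F.
rewrite (path_sortedE (@le_trans _ _)) => /andP[/allP xF _] ux.
rewrite ux add1n; congr S; apply/eqP; rewrite -all_count; apply/allP => y /xF.
exact: lt_le_trans.
Qed.

Section finitely_many_arrivals.
Context (u : R) (M : nat).
Hypothesis late : forall k, (M <= k)%N -> u < arr k.

Lemma number_in_systemE : number_in_system empty_state a s u =
  (\sum_(k < M) (arr k <= u < dep k)%R)%N.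
Proof.
rewrite /number_in_system; set A := [set k | _].
have AM k : A k -> (k < M)%N.
  by move=> /= /andP[ku _]; rewrite ltnNge; apply: contraL ku => /late; rewrite ltNge.
have finA : finite_set A.
  by apply: (sub_finite_set _ (finite_II M)) => k /AM.
pose p k := (arr k <= u < dep k)%R.
have -> : fset_set A = [fset k in [seq k <- iota 0 M | p k]]%fset.
  apply/fsetP => k; rewrite in_fset_set// !inE mem_filter mem_iota add0n.
  apply/idP/andP => [/set_mem Ak|[pk _]]; last exact: mem_set.
  by split=> //; exact: AM.
rewrite card_fseq undup_id ?filter_uniq ?iota_uniq// size_filter -sum1_count.
by rewrite big_mkcond/= -[M in iota 0 M]subn0 big_mkord; apply: eq_bigr => k _; rewrite -/(p k); case: (p k).
Qed.

Hypothesis a_ge0 : forall i, 0 <= a i.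

Lemma arrival_nondecreasing j k : (j <= k)%N -> arr j <= arr k.
Proof.
move=> jk; rewrite !arrival_empty -(subnKC jk) -addSn big_split_ord/= lerDl.
exact: sumr_ge0.
Qed.

(** If some job waits at time [u], consider the first one, [k].  The servers all
    become free after [u], so at least [n] of the jobs before [k] leave after [u];
    these arrive no later than [k] and do not wait, hence are in service. *)
Lemma no_idling : (0 < n)%N -> 0 <= u ->
  (minn (number_in_system empty_state a s u) n <=
   \sum_(k < M) (sta k <= u < dep k)%R)%N.
Proof.
move=> n0 u0; rewrite number_in_systemE.
have [/existsP[k0 waiting]|/existsPn nowait] :=
    boolP [exists k : 'I_M, (arr k <= u < sta k)%R]; last first.
  rewrite geq_min; apply/orP; left; apply: leq_sum => k _.
  have := nowait k; case: (leP (arr k) u) => //= _; rewrite -leNgt => ->.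
  exact: leqnn.
have exW : exists k, (arr k <= u < sta k)%R by exists k0.
have [k /andP[ku uk] kmin] := ex_minnP exW.
have kM : (k < M)%N by rewrite ltnNge; apply: contraL ku => /late; rewrite ltNge.
have uhead : u < head 0 (free k) by move: uk; rewrite /start lt_max ltNge ku.
rewrite geq_min; apply/orP; right.
rewrite -[leqLHS](size_free_times k n0) -(lt_head_count uhead).
apply: leq_trans (count_free_times k u0) _.
rewrite -(subnKC (ltnW kM)) big_split_ord/= -[leqLHS]addn0 leq_add//.
apply: leq_sum => j _; case: (ltP u (dep j)) => // _; rewrite andbT.
have ju : arr j <= u by apply: le_trans ku; exact/arrival_nondecreasing/ltnW.
rewrite leNgt; case: ltP => // uj; have := kmin j; rewrite ju uj => /(_ isT).
by rewrite leqNgt ltn_ord.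
Qed.

End finitely_many_arrivals.

(** Service starts no earlier than arrival, so a job stays in the queue at least as
    long as its service time. *)
Lemma infinite_server_le (u : R) M N : (forall k, (M <= k)%N -> u < arr k) ->
  (\sum_(k < N) (arr k <= u < arr k + s k)%R <=
   number_in_system empty_state a s u)%N.
Proof.
move=> late; rewrite (@number_in_systemE u (N + M)); last first.
  by move=> k NMk; apply: late; exact: leq_trans (leq_addl _ _) NMk.
rewrite big_split_ord/= -[leqLHS]addn0 leq_add//; apply: leq_sum => k _.
case: (leP (arr k) u) => //= _; case: ltP => // us.
rewrite (lt_le_trans us)// /departure service_empty lerD2r.
exact: arrival_le_start.
Qed.

(** A job that arrives after the last grid point is never seen in service, and any
    other is seen at most [s k / delta + 1] times. *)
Lemma busy_work_le (delta : R) (L M : nat) : (0 < n)%N -> 0 < delta ->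
  (forall i, 0 <= a i) ->
  (forall k, (M <= k)%N -> L%:R * delta < arr k) ->
  (\sum_(i < L) minn (number_in_system empty_state a s (i%:R * delta)) n)%N%:R <=
  \sum_(k < M) (if arr k <= L%:R * delta
                then Num.max (s k) 0 / delta + 1 else 0).
Proof.
move=> n0 d0 a0 late.
have grid_le (i : 'I_L) : i%:R * delta <= L%:R * delta.
  by rewrite ler_pM2r// ler_nat ltnW.
apply: (@le_trans _ _ (\sum_(i < L) \sum_(k < M)
    (sta k <= i%:R * delta < dep k)%R)%N%:R).
  rewrite ler_nat; apply: leq_sum => i _; apply: no_idling => //.
    by move=> k /late; exact: le_lt_trans.
  by rewrite mulr_ge0// ltW.
rewrite exchange_big/= natr_sum; apply: ler_sum => k _.
case: ifPn => [_|ku].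
  rewrite -(ler_pM2r d0) mulrDl mul1r divfK ?gt_eqF//.
  by rewrite /departure service_empty; exact: grid_count.
rewrite big1// => i _; case: (leP (sta k) _) => //= si.
by move: ku; rewrite (le_trans (arrival_le_start k))// (le_trans si).
Qed.

End sample_path.
(** * Expectations of the queue from the empty state *)

Section poisson_queue.
Context d (T : measurableType d) (R : realType) (P : probability T R).
Context (a s : nat -> {RV P >-> R}) (S : {RV P >-> R}) (lam : R) (n : nat).
Hypothesis lam_gt0 : 0 < lam.
Hypothesis a_law : forall i (B : set R), measurable B ->
  distribution P (a i) B = exponential_prob lam B.
Hypothesis s_law : forall i, same_law (s i) S.
Hypothesis input_indep : mutually_independent
  (fun i : nat + nat => match i with inl j => a j | inr j => s j end).
Hypothesis S_ge0 : {ae P, forall w, 0 <= S w}.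
Hypothesis ES_fin : ('E_P[S] < +oo)%E.
Hypothesis ES_gt0 : (0 < 'E_P[S])%E.
Hypothesis n_gt0 : (0 < n)%N.
Local Open Scope ereal_scope.

Let Q (t : R) (w : T) : nat :=
  number_in_system (empty_state R n) (fun i => a i w) (fun i => s i w) t.
Let c := (lam * fine 'E_P[S])%R.

Let arrival_partial_sum k w :
  arrival (empty_state R n) (fun i => a i w) k = partial_sum a 0 k.+1 w.
Proof. exact: arrival_empty. Qed.

Definition explosion (t : R) : set T :=
  [set w | ~ exists M, forall k, (M <= k)%N ->
     (t < partial_sum a 0 k.+1 w)%R].

(** Borel-Cantelli. *)
Lemma negligible_explosion t : (0 <= t)%R -> P.-negligible (explosion t).
Proof.
move=> t0; pose F k := [set w | (partial_sum a 0 k.+1 w <= t)%R].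
have mF k : measurable (F k) by exact: measurable_arrived.
exists (lim_sup_set F); split.
- by apply: bigcapT_measurable => i; apply: bigcup_measurable.
- apply: lim_sup_set_cvg0 => //.
  apply: (@le_lt_trans _ _ (lam * t)%:E); last exact: ltry.
  apply: lime_le; first exact: is_cvg_nneseries.
  apply: nearW => N; rewrite big_mkord.
  exact: (sum_arrival_prob_le lam_gt0 a_law input_indep).
- move=> w /= /forallNP late M _; have /existsNP[k /not_implyP[Mk]] := late M.
  by move=> /negP; rewrite -leNgt => kt; exists k.
Qed.

Let negative_arrivals : P.-negligible (\bigcup_i [set w | (a i w < 0)%R]).
Proof.
by apply: negligible_bigcup => i; exact: (exponential_negligible_lt0 (a_law i)).
Qed.

Lemma mean_deficit_le eps : (0 < eps)%R -> exists t0 : R, forall t, (t0 <= t)%R ->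
  \int[P]_w (Num.max (c - (Q t w)%:R) 0)%:E <= (Num.sqrt c / 2 + eps)%:E.
Proof.
move=> eps0; have [t0 ht0] := deficit_mean_le lam_gt0 a_law s_law input_indep
  S_ge0 ES_fin ES_gt0 eps0.
exists (Num.max t0 0)%R => t; rewrite ge_max => /andP[/ht0[N hN] t_ge0].
apply: le_trans hN; apply: (ge0_le_integral_lower_ae (negligible_explosion t_ge0)).
- apply/measurable_EFinP; apply: measurable_maxr => //; apply: measurable_funB => //.
  exact: measurable_number_present.
- by move=> w; rewrite lee_fin le_max lexx orbT.
- by move=> w; rewrite lee_fin le_max lexx orbT.
move=> w /contrapT[M late]; rewrite lee_fin.
suff : (number_present a s t N w <= (Q t w)%:R)%R.
  by rewrite -/c /Num.max; case: ltP => ?; case: ltP => ? ?; lra.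
have late' k : (M <= k)%N ->
    (t < arrival (empty_state R n) (fun i => a i w) k)%R.
  by rewrite arrival_partial_sum; exact: late.
have := infinite_server_le (fun i => s i w) N late'.
rewrite -(ler_nat R) natr_sum; apply: le_trans; rewrite le_eqVlt; apply/orP; left.
apply/eqP/eq_bigr => k _; rewrite /present /covers arrival_partial_sum.
by case: (_ && _).
Qed.

(** The indicator that job [k] arrives by time [L * delta] is independent of its
    service time, and at most [lam * L * delta] such arrivals are expected. *)
Lemma mean_busy_grid_le (delta : R) (L : nat) : (0 < delta)%R ->
  \sum_(i < L) \int[P]_w ((minn (Q (i%:R * delta) w) n)%:R)%:E <=
  (L%:R * (c + lam * delta))%:E.
Proof.
move=> d0; set t := (L%:R * delta)%R.
have t_ge0 : (0 <= t)%R by rewrite mulr_ge0// ltW.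
pose g (x : R) : \bar R := (Num.max x 0 / delta + 1)%:E.
have g0 x : 0 <= g x.
  by rewrite lee_fin addr_ge0// divr_ge0 ?(ltW d0)// le_max lexx orbT.
have mg : measurable_fun [set: R] g.
  apply/measurable_EFinP; apply: measurable_funD => //; apply: measurable_funM => //.
  exact: measurable_maxr.
pose h k w : \bar R := if (partial_sum a 0 k.+1 w <= t)%R then g (s k w) else 0.
have h0 k w : 0 <= h k w by rewrite /h; case: ifP.
have mh k : measurable_fun [set: T] (h k).
  apply: measurable_fun_ifT => //.
    by apply: measurable_fun_ler => //; exact: measurable_partial_sum.
  by apply: measurableT_comp => //; exact: measurable_funPT.
have bad := negligibleU negative_arrivals (negligible_explosion t_ge0).
apply: (le_trans (ge0_integral_sum_lower _ _ _)) => [i w|]; first by rewrite lee_fin.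
apply: (@le_trans _ _ (\int[P]_w \sum_(k <oo) h k w)).
  apply: (ge0_le_integral_lower_ae bad).
  - by apply: ge0_emeasurable_sum => // k w _ _.
  - by move=> w; apply: sume_ge0 => i _; rewrite lee_fin.
  - by move=> w; apply: nneseries_ge0.
  move=> w /not_orP[a_ge0 /contrapT[M late]].
  have a0 i : (0 <= a i w)%R.
    by rewrite leNgt; apply/negP => ai; apply: a_ge0; exists i.
  have late' k : (M <= k)%N ->
      (t < arrival (empty_state R n) (fun i => a i w) k)%R.
    by rewrite arrival_partial_sum; exact: late.
  apply: le_trans (nneseries_lim_ge M _) => //.
  rewrite sumEFin -natr_sum big_mkord.
  have := busy_work_le (fun i => s i w) n_gt0 d0 a0 late'.
  rewrite -lee_fin => /le_trans; apply; rewrite -sumEFin; apply: lee_sum => k _.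
  by rewrite arrival_partial_sum /h /g; case: ifP.
rewrite integral_nneseries//.
have Eg : \int[P]_w g (S w) = (fine 'E_P[S] / delta + 1)%:E.
  have mS : measurable_fun [set: T] S by exact: measurable_funPT.
  have mpos : measurable_fun [set: T] (fun w => (Num.max (S w) 0)%:E).
    by apply/measurable_EFinP; exact: measurable_maxr.
  transitivity (\int[P]_w ((delta^-1)%:E * (Num.max (S w) 0)%:E + cst 1 w)).
    by apply: eq_integral => w _; rewrite /g /= mulrC.
  rewrite ge0_integralD; [|exact: measurableT| |exact: measurable_funeM|by []|
    exact: measurable_cst]; last first.
    move=> w _; rewrite -EFinM lee_fin mulr_ge0 ?invr_ge0 ?(ltW d0)//.
    by rewrite le_max lexx orbT.
  rewrite ge0_integralZl; [|exact: measurableT|exact: mpos| |]; last 2 first.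
  - by move=> w _; rewrite lee_fin le_max lexx orbT.
  - by rewrite lee_fin invr_ge0 ltW.
  rewrite integral_service_pos// (integral_cst P measurableT) mul1e.
  rewrite [X in _ + X](_ : _ = 1); last exact: probability_setT.
  by rewrite EFinD EFinM fineK 1?muleC// ge0_fin_numE// ltW.
apply: lime_le; first by apply: is_cvg_nneseries => k _ _; exact: integral_ge0.
apply: nearW => N; rewrite big_mkord.
under eq_bigr do rewrite (integral_arrived_service s_law input_indep)// Eg.
rewrite -ge0_sume_distrl//.
apply: (@le_trans _ _ ((lam * t)%:E * (fine 'E_P[S] / delta + 1)%:E)).
  apply: lee_wpmul2r; last exact: (sum_arrival_prob_le lam_gt0 a_law input_indep).
  by rewrite lee_fin addr_ge0// divr_ge0 ?fine_ge0 ?ltW.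
rewrite -EFinM lee_fin le_eqVlt; apply/orP; left; apply/eqP; rewrite /t /c.
by field; rewrite gt_eqF.
Qed.

End poisson_queue.
(** * Passage to the limit and the delay probability *)

Section steady_state.
Context d' (T' : measurableType d') (R : realType) (P' : probability T' R).

Lemma continuous_nat (f : nat -> R) : continuous f.
Proof.
move=> q; have q1 : nbhs q [set q] := discrete_set1 q.
move=> A /nbhs_singleton Afq; rewrite nbhs_simpl /=.
by apply: (filterS _ q1) => x ->.
Qed.

(** If the limit [l] were larger than [B], all terms from some index [i0] on would
    exceed some [b > B], and the sum of the first [i0 + k] terms would exceed
    [(i0 + k) * B] for large [k]. *)
Lemma grid_limit_le (e : R -> \bar R) (l : \bar R) (B delta : R) :
  0 < delta -> (forall t, 0 <= e t)%E -> e @ +oo --> l ->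
  (forall L : nat, \sum_(i < L) e (i%:R * delta)%R <= (L%:R * B)%R%:E)%E ->
  (l <= B%:E)%E.
Proof.
move=> d0 e0 el bound.
have B0 : 0 <= B.
  have := bound 1%N; rewrite big_ord1 mul1r -lee_fin; exact: le_trans.
rewrite leNgt; apply/negP => Bl.
have [b [Bb bl]] : exists b : R, B < b /\ (b%:E < l)%E.
  case: l Bl {el} => [r||//]; last by move=> _; exists (B + 1); rewrite ltry ltrDl.
  by rewrite lte_fin => Br; exists ((B + r) / 2); rewrite lte_fin !midf_lt.
have [t0 [t0_real ht0]] := el _ (open_ereal_gt' bl).
pose i0 := (Num.truncn (Num.max (t0 / delta) 0)).+1.
have late i : (i0 <= i)%N -> (b%:E < e (i%:R * delta)%R)%E.
  move=> ii; apply: ht0; rewrite -ltr_pdivrMr//.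
  apply: le_lt_trans (_ : Num.max (t0 / delta) 0 < _).
    by rewrite le_max lexx.
  by apply: (lt_le_trans (truncnS_gt _)); rewrite ler_nat.
pose k := (Num.truncn (i0%:R * B / (b - B))).+1.
have bB : 0 < b - B by rewrite subr_gt0.
have kB : i0%:R * B < k%:R * (b - B) by rewrite -ltr_pdivrMr// truncnS_gt.
have := bound (i0 + k)%N; rewrite leNgt => /negP; apply.
rewrite big_split_ord/=.
apply: (@lt_le_trans _ _ (k%:R * b)%:E).
  by rewrite lte_fin natrD mulrDl; move: kB; rewrite mulrBr; lra.
apply: (@le_trans _ _ (\sum_(i < k) b%:E)%E).
  by rewrite sumEFin sumr_const card_ord mulr_natl.
apply: (@le_trans _ _ (\sum_(i < k) e ((i0 + i)%N%:R * delta)%R))%E.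
  by apply: lee_sum => i _; apply/ltW/late/leq_addr.
by rewrite leeDr// sume_ge0.
Qed.

Lemma delay_probability_le (Q : {RV P' >-> nat}) (n : nat) (c b : R) :
  c < n%:R ->
  (\int[P']_w ((minn (Q w) n)%:R)%:E <= c%:E)%E ->
  (\int[P']_w (Num.max (c - (Q w)%:R) 0)%:E <= b%:E)%E ->
  (P' [set w | (n <= Q w)%N] <= (b / (n%:R - c))%:E)%E.
Proof.
move=> cn busy deficit.
have mQ (f : nat -> R) : measurable_fun [set: T'] (fun w => (f (Q w))%:E).
  by apply/measurable_EFinP; apply: measurableT_comp => //; exact: measurable_funPT.
have n_gt_c : 0 < n%:R - c by rewrite subr_gt0.
pose E := [set w | (n <= Q w)%N].
have indE w : ((n <= Q w)%N%:R : R) = \1_E w.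
  rewrite indicE; case: (boolP (n <= Q w)%N) => nQ; first by rewrite mem_set.
  by rewrite memNset//; exact/negP.
have mE : measurable E.
  by rewrite -[E]/(Q @^-1` [set q | (n <= q)%N]); exact: measurable_funPTI.
have c0 : 0 <= c.
  rewrite -lee_fin; apply: le_trans busy.
  by apply: integral_ge0 => w _; rewrite lee_fin.
have mean : ((n%:R - c)%:E * P' E + c%:E <= c%:E + b%:E)%E.
  apply: le_trans (leeD busy deficit).
  have mI : measurable_fun [set: T'] (fun w => (\1_E w)%:E : \bar R).
    by apply/measurable_EFinP; exact: measurable_indic.
  have n_ge_c := ltW n_gt_c.
  rewrite -(setIT E) -integral_indic// -ge0_integralZl; [|exact: measurableT|
    exact: mI|by move=> w _; rewrite lee_fin|by rewrite lee_fin].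
  have <- : (\int[P']_w cst c%:E w = c%:E)%E.
    rewrite (integral_cst P' measurableT) [X in (_ * X)%E](_ : _ = 1%E) ?mule1//.
    exact: probability_setT.
  rewrite -ge0_integralD; [|exact: measurableT| |exact: measurable_funeM|
    by move=> w _; rewrite lee_fin|exact: measurable_cst]; last first.
    by move=> w _; rewrite mule_ge0 ?lee_fin.
  rewrite -ge0_integralD; [|exact: measurableT|by move=> w _; rewrite lee_fin|
    exact: (mQ (fun q => (minn q n)%:R))| |
    exact: (mQ (fun q => Num.max (c - q%:R) 0))]; last first.
    by move=> w _; rewrite lee_fin le_max lexx orbT.
  apply: ge0_le_integral_lower => w.
    by rewrite adde_ge0 ?mule_ge0 ?lee_fin.
  rewrite -EFinM -!EFinD lee_fin -indE.
  case: (leqP n (Q w)) => nQ /=; rewrite ?mulr1 ?mulr0 ?add0r.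
    by rewrite subrK lerDl le_max lexx orbT.
  by rewrite -lerBlDl le_max lexx.
have {}mean : ((n%:R - c)%:E * P' E <= b%:E)%E.
  by move: mean; rewrite addeC leeD2lE.
rewrite -[P' _]/(P' E) -(@fineK _ (P' E)) ?fin_num_measure//.
rewrite lee_fin ler_pdivlMr// mulrC -lee_fin EFinM fineK// fin_num_measure//.
Qed.

End steady_state.
Theorem theorem6 (R : realType) (d dQ dW : measure_display)
    (T : measurableType d) (TQ : measurableType dQ) (TW : measurableType dW)
    (P : probability T R) (PQ : probability TQ R) (PW : probability TW R)
    (n : nat) (A S : {RV P >-> R}) (a s : nat -> {RV P >-> R})
    (Qinf : {RV PQ >-> nat}) (Winf : TW -> 'rV[R]_n)
    (n_ge1 : (1 <= n)%N)
    (queue : MGIn A S a s)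
    (ES_fin : ('E_P[S] < +oo)%E)
    (stable : rate_of A < n%:R * rate_of S)
    (Q_exists : steady_state_number n a s Qinf)
    (W_exists : steady_state_residual PW a s Winf) :
  let rho := traffic_intensity n A S in
  (PQ [set w | (n <= Qinf w)%N] <=
   (2^-1 * Num.sqrt rho * (n%:R * (1 - rho) ^+ 2) `^ (- 2^-1))%:E)%E.
Proof.
cbv zeta; set rho := traffic_intensity n A S.
have [lam lam_gt0 A_law] := MGIn_exponential queue.
have a_law i (B : set R) : measurable B ->
    distribution P (a i) B = exponential_prob lam B.
  by move=> mB; rewrite (MGIn_arrival_law queue i mB) A_law.
have S_ge0 := MGIn_service_ge0 queue.
have ES_gt0 := MGIn_service_mean_gt0 queue.
have s_law := MGIn_service_law queue.
have indep := MGIn_independent queue.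
pose e := fine ('E_P[S])%E; pose c := lam * e.
have e_gt0 : 0 < e by rewrite /e fine_gt0// ES_gt0 ES_fin.
have c_gt0 : 0 < c by rewrite mulr_gt0.
have n_gt0 : (0 : R) < n%:R by rewrite ltr0n.
have rateA : rate_of A = lam.
  by rewrite /rate_of (exponential_mean lam_gt0 A_law)/= invrK.
have rateS : rate_of S = e^-1 by [].
have c_lt_n : c < n%:R.
  by move: stable; rewrite rateA rateS ltr_pdivlMr.
have rhoE : rho = c / n%:R.
  by rewrite /rho /traffic_intensity rateA rateS invfM invrK mulrA /c mulrAC.
pose Q t w := number_in_system (empty_state R n) (fun i => a i w) (fun i => s i w) t.
have Q_cvg := Q_exists (empty_state R n).
have busy : (\int[PQ]_w ((minn (Qinf w) n)%:R)%:E <= c%:E)%E.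
  have cvg_busy : (fun t => \int[P]_w ((minn (Q t w) n)%:R)%:E)%E @ +oo -->
      (\int[PQ]_w ((minn (Qinf w) n)%:R)%:E)%E.
    have := Q_cvg (fun q => (minn q n)%:R : R) (@continuous_nat _ _).
    rewrite unlock; apply; exists n%:R => q.
    by rewrite ger0_norm// ler_nat geq_minr.
  apply/lee_addgt0Pr => eps eps0; rewrite -EFinD.
  have delta_gt0 : 0 < eps / lam by rewrite divr_gt0.
  apply: (grid_limit_le delta_gt0 _ cvg_busy) => [t|L].
    by apply: integral_ge0 => w _; rewrite lee_fin.
  have := mean_busy_grid_le lam_gt0 a_law s_law indep S_ge0 ES_fin ES_gt0
    n_ge1 L delta_gt0.
  by rewrite [lam * (eps / lam)]mulrC divfK ?gt_eqF.
have deficit : (\int[PQ]_w (Num.max (c - (Qinf w)%:R) 0)%:E <=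
    (Num.sqrt c / 2)%:E)%E.
  have cvg_deficit : (fun t => \int[P]_w (Num.max (c - (Q t w)%:R) 0)%:E)%E @ +oo -->
      (\int[PQ]_w (Num.max (c - (Qinf w)%:R) 0)%:E)%E.
    have := Q_cvg (fun q => Num.max (c - q%:R) 0 : R) (@continuous_nat _ _).
    rewrite unlock; apply; exists c => q.
    rewrite ger0_norm; last by rewrite le_max lexx orbT.
    by rewrite ge_max (ltW c_gt0) andbT gerBl.
  apply/lee_addgt0Pr => eps eps0; rewrite -EFinD.
  have [t0 ht0] := mean_deficit_le n lam_gt0 a_law s_law indep S_ge0 ES_fin ES_gt0
    eps0.
  apply: (cvge_to_le cvg_deficit); near=> t; apply: ht0.
  by near: t; apply: nbhs_pinfty_ge; exact: num_real.
apply: le_trans (delay_probability_le c_lt_n busy deficit) _.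
rewrite lee_fin le_eqVlt; apply/orP; left; apply/eqP.
have -> : c = n%:R * rho by rewrite rhoE mulrC divfK ?gt_eqF.
have rho_lt1 : rho < 1 by rewrite rhoE ltr_pdivrMr// mul1r.
have om : 0 < 1 - rho by rewrite subr_gt0.
rewrite powRN powR12_sqrt; last by rewrite mulr_ge0 ?sqr_ge0// ltW.
rewrite (sqrtrM rho (ltW n_gt0)) (sqrtrM ((1 - rho) ^+ 2) (ltW n_gt0)).
rewrite sqrtr_sqr gtr0_norm//.
have sn : 0 < Num.sqrt n%:R :> R by rewrite sqrtr_gt0.
have nE : n%:R = Num.sqrt n%:R * Num.sqrt n%:R :> R by rewrite -expr2 sqr_sqrtr// ltW.
set q := Num.sqrt n%:R in sn nE *.
have q_neq0 : q != 0 by rewrite gt_eqF.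
have om_neq0 : 1 - rho != 0 by rewrite gt_eqF.
rewrite nE; field.
by rewrite om_neq0 q_neq0 /= -[X in X - _]mulr1 -mulrBr !mulf_neq0.
Unshelve. all: by end_near. Qed.
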